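(* Let $F_0,F_1,F_2\in\mathbf{C}[x_0,x_1,x_2]$ be nonzero homogeneous polynomials. Let $(p_0,p_1,p_2)$ be a reduced type such that $p_0\le p_1\le p_2$. Then there exists a positive dimensional family of quasi-toric relations of type $(p_0,p_1,p_2)$ of $(F_0,F_1,F_2)$, parametrized by a rational variety, if and only if one of the following occurs: (1) $p_0=p_1=p_2=2$ and there is at least one quasi-toric relation of type $(2,2,2)$ of $(F_0,F_1,F_2)$; or (2) $p_0=1$ and $p_1$ divides $\deg(F_1)-\deg(F_2)$.
   Context: A type is a triple $(p_0,p_1,p_2)$ of positive integers. For a type $(p_0,p_1,p_2)$ put $g=\gcd(p_0,p_1,p_2)$ and, for $\{i,j,k\}=\{0,1,2\}$, $q_i=g\gcd(p_i/g,\,p_jp_k/g^2)$. A type is called reduced if it is the triple $(q_0,q_1,q_2)$ obtained in this way from some type $(p_0,p_1,p_2)$. A quasi-toric relation of type $(p_0,p_1,p_2)$ of $(F_0,F_1,F_2)$ is a triple $(h_0,h_1,h_2)$ of nonzero homogeneous polynomials in $\mathbf{C}[x_0,x_1,x_2]$ such that $F_0h_0^{p_0}+F_1h_1^{p_1}+F_2h_2^{p_2}=0$; it is understood that the three summands are homogeneous of the same degree. Let $d=\mathrm{lcm}(p_0,p_1,p_2)$ and $w_i=d/p_i$. Two quasi-toric relations $(g_0,g_1,g_2)$ and $(h_0,h_1,h_2)$ of type $(p_0,p_1,p_2)$ are equivalent if there exist nonzero homogeneous forms $u,v$ such that $u^{w_i}g_i=v^{w_i}h_i$ for $i=0,1,2$.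 A positive dimensional family of quasi-toric relations parametrized by a rational variety means: a rational variety $T$ over $\mathbf{C}$ of positive dimension, together with an algebraic family $t\mapsto (h_{0,t},h_{1,t},h_{2,t})$ of quasi-toric relations (each $h_{i,t}$ is a form of fixed degree whose coefficients are regular functions of $t\in T$), such that the relations in the family represent infinitely many equivalence classes. *)

(* Defs.v *)
From HB Require Import structures.
From mathcomp Require Import all_boot all_order all_algebra.
From mathcomp Require Import boolp classical_sets functions cardinality reals topology.
From mathcomp Require Import complex mpoly.

Set Implicit Arguments.
Unset Strict Implicit.
Unset Printing Implicit Defensive.

Import GRing.Theory.

Local Open Scope classical_set_scope.
Local Open Scope ring_scope.

(** * Varieties over a field, as spaces with functions

The classical (Serre) language: a variety over the algebraically closed field k
is a topological space with a sheaf of k-valued functions that is locally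
isomorphic to a Zariski-closed subset of k^n. *)

(** A function on an open subset U is represented by a function on the whole
space; [regular_on U f] only constrains f on U (by [regular_local] below). *)
Record fspace (k : fieldType) := FSpace {
  fspace_top :> topologicalType;
  regular_on : set fspace_top -> (fspace_top -> k) -> Prop
}.
Arguments regular_on {k X} U f : rename.

Record sheaf_of_functions (k : fieldType) (X : fspace k) : Prop := {
  regular_sub : forall (U V : set X) (f : X -> k),
    open U -> open V -> V `<=` U -> regular_on U f -> regular_on V f;
  regular_local : forall (U : set X) (f : X -> k), open U ->
    (forall x, U x -> exists (V : set X) (g : X -> k),
       [/\ open V, V x, V `<=` U, regular_on V g & forall y, V y -> f y = g y]) ->
    regular_on U f;
  regular_cst : forall (U : set X) (c : k), open U -> regular_on U (fun=> c);
  regular_add : forall (U : set X) (f g : X -> k), open U ->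
    regular_on U f -> regular_on U g -> regular_on U (fun x => f x + g x);
  regular_mul : forall (U : set X) (f g : X -> k), open U ->
    regular_on U f -> regular_on U g -> regular_on U (fun x => f x * g x);
  regular_inv : forall (U : set X) (f : X -> k), open U -> regular_on U f ->
    open [set x | U x /\ f x != 0] /\
    regular_on [set x | U x /\ f x != 0] (fun x => (f x)^-1)
}.

Definition is_morphism (k : fieldType) (X Y : fspace k) (f : X -> Y) : Prop :=
  continuous f /\
  forall (V : set Y) (phi : Y -> k),
    open V -> regular_on V phi -> regular_on (f @^-1` V) (phi \o f).

Definition isomorphic (k : fieldType) (X Y : fspace k) : Prop :=
  exists (f : X -> Y) (g : Y -> X),
    [/\ is_morphism f, is_morphism g, cancel f g & cancel g f].

(** Meant for open U. *)
Definition open_subspace (k : fieldType) (X : fspace k) (U : set X) :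
    fspace k :=
  @FSpace k (set_type U) (fun W f =>
    exists2 g : X -> k, regular_on (set_val @` W) g
                      & forall y, W y -> f y = g (set_val y)).

(** ** Affine algebraic sets *)

(** An alias of k^n, so that it carries the Zariski topology. *)
Definition zspace (k : fieldType) (n : nat) : Type := {ffun 'I_n -> k}.

HB.instance Definition _ k n := Choice.on (zspace k n).

Definition peval (k : fieldType) (n : nat) (p : {mpoly k[n]}) (x : zspace k n)
    : k :=
  p.@[(x : {ffun 'I_n -> k})].

Definition zero_locus (k : fieldType) (n : nat) (I : set {mpoly k[n]}) :
    set (zspace k n) :=
  [set x | forall p, I p -> peval p x = 0].

Section Zariski.
Variables (k : fieldType) (n : nat).

Definition zariski_open (U : set (zspace k n)) : Prop :=
  exists I : set {mpoly k[n]}, U = ~` zero_locus I.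

Lemma nonzero_locusP (I : set {mpoly k[n]}) (x : zspace k n) :
  (~` zero_locus I) x <-> exists2 p, I p & peval p x != 0.
Proof.
split=> [/existsNP[p /not_implyP[Ip /eqP px]]|[p Ip /eqP px] /(_ _ Ip)//].
by exists p.
Qed.

Lemma zariski_openT : zariski_open setT.
Proof.
exists [set 1]; apply/seteqP; split=> // x _.
by apply/nonzero_locusP; exists 1; rewrite // /peval meval1 oner_neq0.
Qed.

Lemma zariski_openI : setI_closed zariski_open.
Proof.
move=> _ _ [I ->] [J ->].
exists [set r | exists p q, [/\ I p, J q & r = p * q]].
apply/seteqP; split=> x.
  move=> [/nonzero_locusP[p Ip px] /nonzero_locusP[q Jq qx]].
  apply/nonzero_locusP; exists (p * q); first by exists p, q.
  by rewrite /peval mevalM mulf_neq0.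
move=> /nonzero_locusP[_ [p [q [Ip Jq ->]]]].
rewrite /peval mevalM mulf_eq0 negb_or => /andP[px qx].
by split; apply/nonzero_locusP; [exists p|exists q].
Qed.

Lemma zariski_open_bigU (A : Type) (U : A -> set (zspace k n)) :
  (forall a, zariski_open (U a)) -> zariski_open (\bigcup_a U a).
Proof.
move=> /choice[I UE]; exists (\bigcup_a I a); apply/seteqP; split=> x.
  move=> [a _]; rewrite UE => /nonzero_locusP[p Ip px].
  by apply/nonzero_locusP; exists p => //; exists a.
move=> /nonzero_locusP[p [a _ Ip] px].
by exists a => //; rewrite UE; apply/nonzero_locusP; exists p.
Qed.

HB.instance Definition _ := isOpenTopological.Build (zspace k n)
  zariski_openT zariski_openI zariski_open_bigU.

End Zariski.

(** Regular functions on a Zariski-closed subset of k^n are the functions that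
are locally quotients of polynomials. *)
Definition alg_set (k : fieldType) (n : nat) (I : set {mpoly k[n]}) :
    fspace k :=
  @FSpace k (set_type (zero_locus I)) (fun W f =>
    forall x, W x -> exists p q : {mpoly k[n]},
      peval q (set_val x) != 0 /\
      forall y, W y -> peval q (set_val y) != 0 ->
        f y = peval p (set_val y) / peval q (set_val y)).

Definition affine_space (k : fieldType) (n : nat) : fspace k :=
  alg_set (set0 : set {mpoly k[n]}).

(** ** Varieties *)

Definition irreducible_set (T : topologicalType) (Z : set T) : Prop :=
  Z !=set0 /\
  forall U V : set T, open U -> open V ->
    Z `&` U !=set0 -> Z `&` V !=set0 -> Z `&` (U `&` V) !=set0.

Definition locally_affine (k : fieldType) (X : fspace k) : Prop :=
  exists (r : nat) (U : 'I_r -> set X),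
    [/\ forall i, open (U i),
        forall x, exists i, U i x
      & forall i, exists (n : nat) (I : set {mpoly k[n]}),
          isomorphic (open_subspace (U i)) (alg_set I)].

(** Two morphisms from an affine algebraic set agree on a closed set. *)
Definition separated_fspace (k : fieldType) (X : fspace k) : Prop :=
  forall (n : nat) (I : set {mpoly k[n]}) (f g : alg_set I -> X),
    is_morphism f -> is_morphism g -> closed [set z | f z = g z].

Definition variety (k : fieldType) (X : fspace k) : Prop :=
  [/\ sheaf_of_functions X, irreducible_set [set: X], locally_affine X
    & separated_fspace X].

(** Birational to an affine space. *)
Definition is_rational (k : fieldType) (X : fspace k) : Prop :=
  exists (n : nat) (U : set X) (V : set (affine_space k n)),
    [/\ open U, U !=set0, open V, V !=set0
      & isomorphic (open_subspace U) (open_subspace V)].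

(** Krull dimension at least 1. *)
Definition positive_dimensional (k : fieldType) (X : fspace k) : Prop :=
  exists Z0 Z1 : set X,
    [/\ closed Z0, irreducible_set Z0, closed Z1, irreducible_set Z1
      & Z0 `<` Z1].

(** * Quasi-toric relations *)

Notation triple T := ('I_3 -> T).

Definition is_type (p : triple nat) : Prop := forall i, (0 < p i)%N.

(** The triple (q_0, q_1, q_2) attached to (p_0, p_1, p_2); the product is
p_j p_k, where {i, j, k} = {0, 1, 2}. *)
Definition reduction (p : triple nat) : triple nat :=
  fun i =>
    let g := (\big[gcdn/0]_(j < 3) p j)%N in
    (g * gcdn (p i %/ g) ((\prod_(j < 3 | j != i) p j) %/ g ^ 2))%N.

Definition reduced_type (q : triple nat) : Prop :=
  exists2 p, is_type p & q = reduction p.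

Definition weight (p : triple nat) (i : 'I_3) : nat :=
  ((\big[lcmn/1]_(j < 3) p j) %/ p i)%N.

Section QuasiToric.
Variable k : fieldType.
Local Notation poly3 := {mpoly k[3]}.

Definition is_form (f : poly3) : Prop := f != 0 /\ f \is homog mdeg.

(** [msize] is one more than the total degree. *)
Definition degree (f : poly3) : nat := (msize f).-1.

Definition quasi_toric (p : triple nat) (F h : triple poly3) : Prop :=
  [/\ forall i, is_form (h i),
      exists D : nat, forall i, F i * h i ^+ p i \is D.-homog
    & \sum_(i < 3) F i * h i ^+ p i = 0].

Definition qt_equiv (p : triple nat) (g h : triple poly3) : Prop :=
  exists u v : poly3, [/\ is_form u, is_form v
    & forall i, u ^+ weight p i * g i = v ^+ weight p i * h i].

Definition qt_class (p : triple nat) (F h : triple poly3) :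
    set (triple poly3) :=
  [set h' | quasi_toric p F h' /\ qt_equiv p h h'].

Definition algebraic_family (T : fspace k) (h : T -> triple poly3) : Prop :=
  (exists e : triple nat, forall t i, h t i \is (e i).-homog) /\
  (forall i (m : 'X_{1..3}), regular_on [set: T] (fun t => (h t i)@_m)).

Definition positive_dim_rational_family (p : triple nat) (F : triple poly3) :
    Prop :=
  exists (T : fspace k) (h : T -> triple poly3),
    [/\ [/\ variety T, is_rational T & positive_dimensional T],
        algebraic_family h,
        forall t, quasi_toric p F (h t)
      & infinite_set (range (fun t => qt_class p F (h t)))].

End QuasiToric.

(* Main.v *)
Require Import Defs.
From mathcomp Require Import all_boot all_order all_algebra.
From mathcomp Require Import boolp classical_sets functions cardinality reals.
From mathcomp Require Import topology complex mpoly.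
From mathcomp Require Import ring zify.

(** The three summands of a quasi-toric relation, at a fixed point x of C^3,
satisfy F_0(x) u^p_0 + F_1(x) v^p_1 + F_2(x) w^p_2 = 0, the equation of a curve
in a weighted projective plane. A family of relations over T gives, for every
x, a map from T to this curve, and the theorem says when the curve is rational.

Necessity. In a reduced type any two of the p_i already have the least common
multiple d of all three ([reduced_type_lcm]). For such a type with
2 <= p_0, other than (2,2,2), one has 1/p_0 + 1/p_1 + 1/p_2 <= 1
([hyperbolic_exponents]), and then the curve carries no nonconstant rational
curve: for one-variable polynomials this is the Mason-Stothers argument, applied
to a relation between powers ([power_relation_const]). In a relation whose terms
have a common root, the least of the three orders is attained twice, hence is a
multiple of d, so the common factor can be divided out of U, V and W
([power_relation_divide]); once U, V and W are coprime, U^(p-1) V^(q-1) W^(r-1)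
divides the Wronskian of any two terms, whose degree is too small
([coprime_power_relation]).

A point in some nonempty open set of a rational variety is joined to all nearby
points by images of lines ([rational_curves]), so the ratios of the three terms
are constant near this point, hence, regular functions on an irreducible space
being determined on a nonempty open set, on the whole of T
([regular_quasi_toric_const]). Since this holds for every x, any two relations
of the family satisfy an identity of forms,
h_(0,t)^p_0 / h_(0,s)^p_0 = h_(i,t)^p_i / h_(i,s)^p_i for every i. The common
value is a p_0-th and a p_1-th power, so a d-th power of a quotient u/v of
forms, and h_(i,t) is (u/v)^(w_i) h_(i,s) up to a p_i-th root of unity
([equal_ratios_equiv]). There are finitely many choices of these roots of unity,
so finitely many classes ([finite_qt_classes]). If p_0 = 1 then p_1 = p_2, and
the congruence of degrees comes from homogeneity.

Sufficiency. The parameter space is the affine line, and the parameter t enters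
through a linear form l_t = t x_0 + x_i. For the type (1,m,m), take h_1 and h_2
to be multiples of F_0, of suitable degrees, one of them times x_0, the other
times l_t; then h_0 is determined ([linear_family]). For the type (2,2,2), a
relation is a point on a conic over the field of rational functions, and the
lines through it, with slopes l_t / x_0, give other points ([conic_family]). The
relations must have nonzero components for every t, without exception: whenever
a bad value of t exists for l_t = t x_0 + x_1, none exists for
l_t = t x_0 + x_2 ([moving_line_avoids]). *)

Set Implicit Arguments.
Unset Strict Implicit.
Unset Printing Implicit Defensive.

Import Order.TTheory GRing.Theory Num.Theory.

Local Open Scope classical_set_scope.
Local Open Scope ring_scope.

(** * Triples *)

Lemma big3 (T : Type) (idx : T) (op : Monoid.law idx) (F : 'I_3 -> T) :
  \big[op/idx]_(i < 3) F i = op (op (F 0) (F 1)) (F 2%:R).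
Proof.
rewrite !big_ord_recl big_ord0 Monoid.mulm1 Monoid.mulmA.
by congr (op (op (F _) (F _)) (F _)); apply: val_inj.
Qed.

Lemma sum3E (V : nmodType) (F : 'I_3 -> V) :
  \sum_(i < 3) F i = F 0 + F 1 + F 2%:R.
Proof. exact: big3. Qed.

Lemma forall3 (P : 'I_3 -> Prop) : P 0 -> P 1 -> P 2%:R -> forall i, P i.
Proof.
move=> P0 P1 P2 [[|[|[|//]]] lt].
- by have -> : Ordinal lt = 0 by apply: val_inj.
- by have -> : Ordinal lt = 1 by apply: val_inj.
- by have -> : Ordinal lt = 2%:R by apply: val_inj.
Qed.

(** * Polynomials vanishing at every point *)

Section Vanishing.
Variable K : numFieldType.

Lemma poly_vanishing (p : {poly K}) : (forall x, p.[x] = 0) -> p = 0.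
Proof.
move=> p0; apply: (@roots_geq_poly_eq0 _ p [seq i%:R | i <- iota 0 (size p)]).
- by apply/allP => x _; rewrite /root p0.
- rewrite map_inj_uniq ?iota_uniq// => i j /eqP; rewrite eqr_nat => /eqP//.
- by rewrite size_map size_iota.
Qed.

(** The coefficients of p are those of p seen as a polynomial in its last variable. *)
Lemma muni_eq0 n (p : {mpoly K[n.+1]}) : muni p = 0 -> p = 0.
Proof.
move=> p0; apply/mpolyP => m; rewrite mcoeff0.
have := congr1 (fun q : {poly {mpoly K[n]}} =>
   (q`_(m ord_max))@_[multinom (m (widen_ord (leqnSn n) i)) | i < n]) p0.
rewrite coef0 mcoeff0 => <-; rewrite muniE coef_sum raddf_sum /=.
have E (m' : 'X_{1..n.+1}) :
  ((p@_m' *: 'X_[[multinom (m' (widen_ord (leqnSn n) i)) | i < n]]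
     *: 'X^(m' ord_max))`_(m ord_max))
      @_[multinom (m (widen_ord (leqnSn n) i)) | i < n] = p@_m' *+ (m' == m).
  rewrite coefZ coefXn eq_sym; have [mm'|] := eqVneq (m' ord_max) (m ord_max).
    rewrite mulr1 mcoeffZ mcoeffX; have [<-|/eqP ne] := eqVneq m' m.
      by rewrite eqxx mulr1.
    case: eqP => [/mnmP e|]; last by rewrite mulr0.
    case: ne; apply/mnmP => i; have [j ->|->//] := unliftP ord_max i.
    have -> : lift ord_max j = widen_ord (leqnSn n) j.
      by apply/val_inj; rewrite /= /bump leqNgt ltn_ord.
    by have := e j; rewrite !mnmE.
  by rewrite mulr0 mcoeff0; have [->|//] := eqVneq m' m; rewrite eqxx.
rewrite (eq_bigr _ (fun i _ => E i)); have [mp|mp] := boolP (m \in msupp p).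
  rewrite (bigD1_seq m) ?msupp_uniq//= eqxx mulr1n big1 ?addr0// => m' /negPf.
  by move=> ->; rewrite mulr0n.
rewrite (memN_msupp_eq0 mp) big1_seq// => m' /= m'p.
by have [e|] := eqVneq m' m; [rewrite -e m'p in mp | rewrite mulr0n].
Qed.

(** By induction on the number of variables: for each value of the first n
variables, p becomes a polynomial in the last one that has infinitely many roots. *)
Lemma mpoly_vanishing n (p : {mpoly K[n]}) : (forall x, p.@[x] = 0) -> p = 0.
Proof.
elim: n p => [|n IH] p p0.
  apply/mpolyP => m; rewrite mcoeff0.
  have m0 : m = 0%MM by apply/mnmP => -[].
  have pE : p = (p@_0)%:MP.
    apply/mpolyP => m'; rewrite mcoeffC.
    have -> : m' = 0%MM by apply/mnmP => -[].
    by rewrite eqxx mulr1.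
  by have := p0 (fun=> 0); rewrite pE mevalC m0 mcoeffC eqxx mulr1.
apply: muni_eq0; apply/polyP => k; rewrite coef0; apply: IH => x.
suff /(congr1 (fun q : {poly K} => q`_k)) : map_poly (meval x) (muni p) = 0.
  by rewrite coef_map coef0.
apply: poly_vanishing => c.
pose y (i : 'I_n.+1) := oapp x c (unlift ord_max i).
rewrite -(p0 y) muniE mevalE rmorph_sum horner_sum; apply: eq_bigr => m _ /=.
rewrite map_polyZ map_polyXn hornerZ hornerXn /= mevalZ mevalX -mulrA.
congr (_ * _); rewrite [in RHS]big_ord_recr /= /y unlift_none /=; congr (_ * _).
apply: eq_bigr => i _; rewrite mnmE.
have {2}-> : widen_ord (leqnSn n) i = lift ord_max i.
  by apply/val_inj; rewrite /= /bump leqNgt ltn_ord.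
by rewrite liftK.
Qed.

End Vanishing.

(** * Relations between powers of one-variable polynomials *)

Section Wronskian.
Variable K : numFieldType.
Implicit Types X Y Z U : {poly K}.

Definition wronskian X Y := X^`() * Y - X * Y^`().

(** Up to rotation, the Wronskian depends only on the relation and not on the pair
of its terms; all three degree bounds therefore concern one polynomial. *)
Lemma wronskian_rot X Y Z :
  X + Y + Z = 0 -> wronskian Y Z = wronskian X Y.
Proof.
move=> /eqP; rewrite addrC addr_eq0 => /eqP ->.
by rewrite /wronskian derivN derivD; ring.
Qed.

Lemma size_wronskian X Y : X != 0 -> Y != 0 ->
  (size (wronskian X Y) <= (size X).-1 + (size Y).-1)%N.
Proof.
move=> X0 Y0; have := lt_size_deriv X0; have := lt_size_deriv Y0.
rewrite -!size_poly_gt0 in X0 Y0; move=> sY sX.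
apply: leq_trans (size_polyD _ _) _; rewrite size_polyN geq_max.
by apply/andP; split; apply: leq_trans (size_polyMleq _ _) _;
  set x := size X in X0 sX *; set y := size Y in Y0 sY *;
  move: (size X^`()) (size Y^`()) sX sY => x' y'; lia.
Qed.

Lemma exp_dvdp_wronskian (a : K) U n Y : U ^+ n.-1 %| wronskian (a *: U ^+ n) Y.
Proof.
rewrite /wronskian derivZ deriv_exp; case: n => [|n] /=; first by rewrite dvd1p.
apply: dvdp_sub; last first.
  by rewrite -scalerAl -mul_polyC exprS dvdp_mull// dvdp_mulr// dvdp_mull.
by rewrite dvdp_mulr// -mul_polyC -mulr_natl !dvdp_mull.
Qed.

Lemma deriv_eq0 X : X^`() = 0 -> (size X <= 1)%N.
Proof.
move=> X'0; apply/leq_sizeP => -[//|j] _; apply/eqP.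
have /eqP := congr1 (fun P : {poly K} => P`_j) X'0.
by rewrite coef_deriv coef0 mulrn_eq0.
Qed.

(** If X' Y = X Y' with X and Y coprime, then X divides X', whose degree is
smaller. *)
Lemma coprimep_wronskian_eq0 X Y :
  coprimep X Y -> wronskian X Y = 0 -> (size X <= 1)%N.
Proof.
move=> cXY /eqP; rewrite subr_eq0 => /eqP e.
have XX' : X %| X^`() by rewrite -(Gauss_dvdpl _ cXY) e dvdp_mulIl.
have [->|X0] := eqVneq X 0; first by rewrite size_poly0.
apply: deriv_eq0; apply/eqP; apply: contraLR XX' => X'0.
by rewrite gtNdvdp // lt_size_deriv.
Qed.

End Wronskian.

(** With S = u + v + w, the three bounds give S <= (S - 1) (1/p + 1/q + 1/r), while
the sum of the inverses is at most 1. *)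
Lemma degree_sum_absurd (p q r u v w : nat) :
  (0 < p)%N -> (0 < q)%N -> (0 < r)%N ->
  (q * r + p * r + p * q <= p * q * r)%N ->
  (p * u < u + v + w)%N -> (q * v < u + v + w)%N -> (r * w < u + v + w)%N ->
  False.
Proof.
move=> p0 q0 r0 hyp hu hv hw.
have e : (p * q * r * (u + v + w) =
  q * r * (p * u) + p * r * (q * v) + p * q * (r * w))%N by ring.
move: (u + v + w)%N e hu hv hw => [//|S] e hu hv hw.
have := leq_mul hyp (leqnn S).
have pqr0 : (0 < p * q * r)%N by rewrite !muln_gt0 p0 q0.
rewrite !ltnS in hu hv hw; rewrite !mulnDl => h1.
move: e; rewrite mulnS => e.
have := leq_trans (leq_add (leq_add (leq_mul (leqnn (q * r)%N) hu)
  (leq_mul (leqnn (p * r)%N) hv)) (leq_mul (leqnn (p * q)%N) hw)) h1.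
by rewrite -e leqNgt -[X in (X < _)%N]add0n ltn_add2r pqr0.
Qed.

(** The bookkeeping of the Mason-Stothers inequality: a, b and c are the sizes of
U^(p-1), V^(q-1) and W^(r-1), whose product divides the Wronskian, and d is the
size of the Wronskian. *)
Lemma wronskian_degrees (p q r u v w d a b c : nat) :
  (0 < p)%N -> (0 < q)%N -> (0 < r)%N ->
  (0 < a)%N -> (0 < b)%N -> (0 < c)%N ->
  a.-1 = (u * p.-1)%N -> b.-1 = (v * q.-1)%N -> c.-1 = (w * r.-1)%N ->
  (a + b + c <= d.+2)%N -> (d <= p * u + q * v)%N ->
  (r * w < u + v + w)%N.
Proof.
case: p q r => [//|p] [//|q] [//|r] _ _ _ /=; rewrite !mulSn.
rewrite (mulnC u) (mulnC v) (mulnC w); move: (p * u)%N (q * v)%N (r * w)%N; lia.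
Qed.

(** The Mason-Stothers theorem for powers. The Wronskian of two terms is divisible
by U^(p-1), V^(q-1) and W^(r-1), so by their product; unless it vanishes, its
degree forces p u, q v and r w to be less than u + v + w, where u, v and w are
the degrees of U, V and W. *)
Lemma coprime_power_relation (K : numFieldType) (p q r : nat) (a b c : K)
    (U V W : {poly K}) :
  (0 < p)%N -> (0 < q)%N -> (0 < r)%N ->
  (q * r + p * r + p * q <= p * q * r)%N ->
  a != 0 -> b != 0 -> c != 0 -> U != 0 -> V != 0 -> W != 0 ->
  coprimep U V -> coprimep V W -> coprimep W U ->
  a *: U ^+ p + b *: V ^+ q + c *: W ^+ r = 0 ->
  [/\ (size (U ^+ p) <= 1)%N, (size (V ^+ q) <= 1)%N
    & (size (W ^+ r) <= 1)%N].
Proof.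
move=> p0 q0 r0 hyp a0 b0 c0 U0 V0 W0 UV VW WU rel.
set X := a *: U ^+ p in rel *; set Y := b *: V ^+ q in rel *.
set Z := c *: W ^+ r in rel *.
have rel2 : Y + Z + X = 0 by rewrite -rel; ring.
have e1 := wronskian_rot rel; have e2 := wronskian_rot rel2.
have nz (x : K) (P : {poly K}) n : x != 0 -> P != 0 -> x *: P ^+ n != 0.
  by move=> x0 P0; rewrite scaler_eq0 negb_or x0 expf_neq0.
have sz (x : K) (P : {poly K}) n : x != 0 -> P != 0 ->
    (size (x *: P ^+ n)).-1 = (n * (size P).-1)%N.
  by move=> x0 P0; rewrite size_scale// size_exp /= mulnC.
have cop (x y : K) (P Q : {poly K}) m n : x != 0 -> y != 0 -> coprimep P Q ->
    coprimep (x *: P ^+ m) (y *: Q ^+ n).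
  move=> x0 y0 PQ.
  by rewrite coprimepZl// coprimepZr// coprimep_expl// coprimep_expr.
have [D0|D0] := eqVneq (wronskian X Y) 0.
  have := coprimep_wronskian_eq0 (cop _ _ _ _ p q a0 b0 UV) D0.
  have := coprimep_wronskian_eq0 (cop _ _ _ _ q r b0 c0 VW) (etrans e1 D0).
  have := coprimep_wronskian_eq0 (cop _ _ _ _ r p c0 a0 WU)
    (etrans e2 (etrans e1 D0)).
  by rewrite !size_scale.
exfalso.
have dU : U ^+ p.-1 %| wronskian X Y by apply: exp_dvdp_wronskian.
have dV : V ^+ q.-1 %| wronskian X Y by rewrite -e1; apply: exp_dvdp_wronskian.
have dW : W ^+ r.-1 %| wronskian X Y.
  by rewrite -e1 -e2; apply: exp_dvdp_wronskian.
have dvd : U ^+ p.-1 * V ^+ q.-1 * W ^+ r.-1 %| wronskian X Y.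
  rewrite !Gauss_dvdp ?dU ?dV ?dW// ?coprimepMl ?coprimep_expl ?coprimep_expr//.
  by rewrite coprimep_sym.
have := dvdp_leq D0 dvd.
rewrite size_mul ?mulf_neq0 ?expf_neq0// size_mul ?expf_neq0//.
have s1 := size_wronskian (nz _ _ p a0 U0) (nz _ _ q b0 V0).
have s2 := size_wronskian (nz _ _ q b0 V0) (nz _ _ r c0 W0).
have s3 := size_wronskian (nz _ _ r c0 W0) (nz _ _ p a0 U0).
rewrite e1 in s2; rewrite e2 e1 in s3; rewrite !sz// in s1 s2 s3.
have gt (P : {poly K}) n : P != 0 -> (0 < size (P ^+ n))%N.
  by move=> P0; rewrite size_poly_gt0 expf_neq0.
have gU := gt _ p.-1 U0; have gV := gt _ q.-1 V0; have gW := gt _ r.-1 W0.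
have eU := size_exp U p.-1; have eV := size_exp V q.-1; have eW := size_exp W r.-1.
move=> sD.
have {}sD : (size (U ^+ p.-1) + size (V ^+ q.-1) + size (W ^+ r.-1)
    <= (size (wronskian X Y)).+2)%N.
  by move: sD gU gV gW; clear; do 4!move: (size _); lia.
apply: (degree_sum_absurd p0 q0 r0 hyp).
- rewrite -addnA addnC; apply: (wronskian_degrees q0 r0 p0 gV gW gU eV eW eU _ s2).
  by rewrite addnC addnA.
- rewrite addnC addnA; apply: (wronskian_degrees r0 p0 q0 gW gU gV eW eU eV _ s3).
  by rewrite -addnA addnC.
- exact: (wronskian_degrees p0 q0 r0 gU gV gW eU eV eW sD s1).
Qed.

(** A term of strictly lowest order at x cannot be cancelled by the two others. *)
Lemma lowest_term_absurd (K : fieldType) (x a b c : K) (U V W : {poly K})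
    (p q r i j k : nat) :
  a != 0 -> ~~ root U x ->
  a *: (U * ('X - x%:P) ^+ i) ^+ p + b *: (V * ('X - x%:P) ^+ j) ^+ q
    + c *: (W * ('X - x%:P) ^+ k) ^+ r = 0 ->
  (p * i < q * j)%N -> (p * i < r * k)%N -> False.
Proof.
move=> a0 Ux; set L := 'X - x%:P => rel qj rk.
have L0 : L != 0 by rewrite polyXsubC_eq0.
have dvd (y : K) (P : {poly K}) m n : (p * i < m * n)%N ->
    L ^+ (p * i).+1 %| y *: (P * L ^+ n) ^+ m.
  move=> lt; rewrite -mul_polyC dvdp_mull// exprMn -exprM dvdp_mull//.
  by apply: dvdp_exp2l; rewrite (mulnC n).
have : L ^+ (p * i).+1 %| a *: (U * L ^+ i) ^+ p.
  move/eqP: rel; rewrite -addrA addr_eq0 => /eqP ->.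
  by rewrite dvdpNr; apply: dvdp_add; apply: dvd.
rewrite exprMn -exprM -mul_polyC mulrA (mulnC i) exprS dvdp_mul2r ?expf_neq0//.
rewrite mul_polyC dvdpZr// /L dvdp_XsubCl rootE horner_exp expf_eq0.
by move=> /andP[_]; rewrite -rootE (negPf Ux).
Qed.

Lemma lcm_exponent_bound (p q i j : nat) : (0 < p * i)%N ->
  (p * i)%N = (q * j)%N -> (lcmn p q <= p * i)%N.
Proof.
move=> pi0 e; apply: dvdn_leq => //.
by rewrite dvdn_lcm dvdn_mulr// e dvdn_mulr.
Qed.

(** The least of p i, q j and r k is attained twice, so it is a positive common
multiple of two of the exponents, hence at least d. *)
Lemma common_root_exponents (p q r d i j k : nat) :
  lcmn p q = d -> lcmn q r = d -> lcmn r p = d ->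
  (0 < p * i)%N -> (0 < q * j)%N -> (0 < r * k)%N ->
  ~~ ((p * i < q * j) && (p * i < r * k))%N ->
  ~~ ((q * j < r * k) && (q * j < p * i))%N ->
  ~~ ((r * k < p * i) && (r * k < q * j))%N ->
  [/\ (d <= p * i)%N, (d <= q * j)%N & (d <= r * k)%N].
Proof.
move=> dpq dqr drp pi0 qj0 rk0.
have := @lcm_exponent_bound p q i j pi0; rewrite dpq.
have := @lcm_exponent_bound q r j k qj0; rewrite dqr.
have := @lcm_exponent_bound r p k i rk0; rewrite drp.
move: (p * i)%N (q * j)%N (r * k)%N => x y z h1 h2 h3 n1 n2 n3.
have [|[|]] : (x = y /\ x <= z \/ y = z /\ y <= x \/ z = x /\ z <= y)%N by lia.
- by move=> [/h3] *; split; lia.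
- by move=> [/h2] *; split; lia.
- by move=> [/h1] *; split; lia.
Qed.

Lemma root_split (K : fieldType) (x : K) (U : {poly K}) : U != 0 -> root U x ->
  exists i V, [/\ (0 < i)%N, ~~ root V x & U = V * ('X - x%:P) ^+ i].
Proof.
move=> U0 Ux; have [i [V]] := multiplicity_XsubC U x; rewrite U0 /= => Vx e.
exists i, V; split=> //; case: i e => // e; move: Vx Ux; rewrite e expr0 mulr1.
by move=> /negPf ->.
Qed.

Lemma power_relation_root (K : fieldType) (p q r : nat) (a b c x : K)
    (U V W : {poly K}) : (0 < r)%N -> c != 0 -> (0 < p)%N -> (0 < q)%N ->
  a *: U ^+ p + b *: V ^+ q + c *: W ^+ r = 0 ->
  root U x -> root V x -> root W x.
Proof.
move=> r0 c0 p0 q0 /(congr1 (horner^~ x)) + /rootP Ux /rootP Vx.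
rewrite horner0 !hornerD !hornerZ !horner_exp Ux Vx !expr0n !gtn_eqF//.
rewrite !mulr0 !add0r => /eqP; rewrite mulf_eq0 (negPf c0) expf_eq0.
by rewrite rootE => /andP[].
Qed.

Section PowerRelation.
Variables (K : numClosedFieldType) (p q r d : nat).
Hypotheses (p0 : (0 < p)%N) (q0 : (0 < q)%N) (r0 : (0 < r)%N).
Hypotheses (dpq : lcmn p q = d) (dqr : lcmn q r = d) (drp : lcmn r p = d).
Hypothesis hyperbolic : (q * r + p * r + p * q <= p * q * r)%N.

(** The terms are proportional to constants with a common factor G, which may
vanish; this form avoids quotients and includes relations with a zero term. *)
Definition constant_ratios (P Q R : {poly K}) :=
  exists (G : {poly K}) (a b c : K), [/\ P = a *: G, Q = b *: G & R = c *: G].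

(** The factors divided out have orders d/p, d/q and d/r, so that they contribute
the same factor, of order d, to the three terms of the relation. *)
Lemma power_relation_divide (a b c x : K) (U V W : {poly K}) :
  a != 0 -> b != 0 -> c != 0 -> U != 0 -> V != 0 -> W != 0 ->
  a *: U ^+ p + b *: V ^+ q + c *: W ^+ r = 0 ->
  root U x -> root V x -> root W x ->
  exists U1 V1 W1 : {poly K},
    [/\ U = U1 * ('X - x%:P) ^+ (d %/ p), V = V1 * ('X - x%:P) ^+ (d %/ q)
      & W = W1 * ('X - x%:P) ^+ (d %/ r)].
Proof.
move=> a0 b0 c0 U0 V0 W0 rel Ux Vx Wx.
have [i [U' [i0 U'x eU]]] := root_split U0 Ux.
have [j [V' [j0 V'x eV]]] := root_split V0 Vx.
have [k [W' [k0 W'x eW]]] := root_split W0 Wx.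
have rel1 := rel; rewrite eU eV eW in rel1.
have rel2 := rel1; rewrite -addrA addrC in rel2.
have rel3 := rel1; rewrite addrC addrA in rel3.
have [||||||di dj dk] :=
  common_root_exponents (i := i) (j := j) (k := k) dpq dqr drp.
- by rewrite muln_gt0 p0.
- by rewrite muln_gt0 q0.
- by rewrite muln_gt0 r0.
- by apply/negP => /andP[]; apply: (lowest_term_absurd a0 U'x rel1).
- by apply/negP => /andP[]; apply: (lowest_term_absurd b0 V'x rel2).
- by apply/negP => /andP[]; apply: (lowest_term_absurd c0 W'x rel3).
have sub (m n : nat) (P : {poly K}) : (0 < m)%N -> (d <= m * n)%N ->
    P * ('X - x%:P) ^+ n =
      P * ('X - x%:P) ^+ (n - d %/ m) * ('X - x%:P) ^+ (d %/ m).
  move=> m0 dn; rewrite -mulrA -exprD subnK//.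
  by rewrite -(mulKn n m0) leq_div2r.
exists (U' * ('X - x%:P) ^+ (i - d %/ p)), (V' * ('X - x%:P) ^+ (j - d %/ q)),
  (W' * ('X - x%:P) ^+ (k - d %/ r)).
by split; rewrite ?eU ?eV ?eW; apply: sub.
Qed.

(** By induction on the degree of U: common roots are divided out by
[power_relation_divide] until the three polynomials are coprime, and then they
are constant. Two of them cannot share a root that is not a root of the third. *)
Lemma power_relation_const (a b c : K) (U V W : {poly K}) :
  a != 0 -> b != 0 -> c != 0 -> a *: U ^+ p + b *: V ^+ q + c *: W ^+ r = 0 ->
  constant_ratios (U ^+ p) (V ^+ q) (W ^+ r).
Proof.
move=> a0 b0 c0.
have [->|U0] := eqVneq U 0.
  rewrite expr0n gtn_eqF// scaler0 add0r => /eqP; rewrite addr_eq0 => /eqP e.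
  (* If U = 0, the two other terms are opposite. *)
  exists (W ^+ r), 0, (- (b^-1 * c)), 1; rewrite scale0r scale1r; split=> //.
  by rewrite scaleNr -scalerA -scalerN -e scalerA mulVf// scale1r.
have [->|V0] := eqVneq V 0.
  rewrite [0 ^+ q]expr0n gtn_eqF// scaler0 addr0 => /eqP; rewrite addr_eq0 => /eqP e.
  exists (W ^+ r), (- (a^-1 * c)), 0, 1; rewrite scale0r scale1r; split=> //.
  by rewrite scaleNr -scalerA -scalerN -e scalerA mulVf// scale1r.
have [->|W0] := eqVneq W 0.
  rewrite [0 ^+ r]expr0n gtn_eqF// scaler0 addr0 => /eqP; rewrite addr_eq0 => /eqP e.
  exists (V ^+ q), (- (a^-1 * b)), 1, 0; rewrite scale0r scale1r; split=> //.
  by rewrite scaleNr -scalerA -scalerN -e scalerA mulVf// scale1r.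
have [n] := ubnP (size U); elim: n => // n IH in U V W U0 V0 W0 *.
rewrite ltnS => sU rel.
have rel2 := rel; rewrite -addrA addrC in rel2.
have rel3 := rel; rewrite addrC addrA in rel3.
have [[x [Ux Vx Wx]]|nx] := pselect (exists x, [/\ root U x, root V x & root W x]).
  have [U1 [V1 [W1 [eU eV eW]]]] :=
    power_relation_divide a0 b0 c0 U0 V0 W0 rel Ux Vx Wx.
  set L := 'X - x%:P in eU eV eW.
  have L0 : L != 0 by rewrite polyXsubC_eq0.
  have dp : (p * (d %/ p))%N = d by rewrite mulnC divnK// -dpq dvdn_lcml.
  have dq : (q * (d %/ q))%N = d by rewrite mulnC divnK// -dpq dvdn_lcmr.
  have dr : (r * (d %/ r))%N = d by rewrite mulnC divnK// -dqr dvdn_lcmr.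
  have ex (m : nat) (P : {poly K}) : (m * (d %/ m))%N = d ->
      (P * L ^+ (d %/ m)) ^+ m = L ^+ d * P ^+ m.
    by move=> dm; rewrite exprMn -exprM mulnC dm mulrC.
  have d0 : (0 < d)%N by rewrite -dpq lcmn_gt0 p0.
  have U10 : U1 != 0 by move: U0; rewrite eU; apply: contraNneq => ->; rewrite mul0r.
  have V10 : V1 != 0 by move: V0; rewrite eV; apply: contraNneq => ->; rewrite mul0r.
  have W10 : W1 != 0 by move: W0; rewrite eW; apply: contraNneq => ->; rewrite mul0r.
  have [||G [a' [b' [c' [e1 e2 e3]]]]] := IH U1 V1 W1 U10 V10 W10.
  - apply: leq_trans sU; rewrite eU size_mul ?expf_neq0//.
    rewrite size_exp_XsubC addnS /= -[X in (X < _)%N]addn0 ltn_add2l.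
    by move: d0; rewrite -{1}dp muln_gt0 => /andP[].
  - apply: (mulfI (expf_neq0 d L0)); rewrite mulr0 -rel eU eV eW !ex//.
    by rewrite !mulrDr !scalerAr.
  - exists (L ^+ d * G), a', b', c'.
    by rewrite eU eV eW !ex// e1 e2 e3 !scalerAr.
have cop (P Q : {poly K}) :
    (forall x, root P x -> root Q x -> False) -> coprimep P Q.
  move=> h; apply/Pdiv.ClosedField.coprimepP => x Px; apply/negP => Qx.
  exact: h Px Qx.
have [|||sU1 sV1 sW1] :=
  coprime_power_relation p0 q0 r0 hyperbolic a0 b0 c0 U0 V0 W0 _ _ _ rel.
- apply: cop => x Ux Vx; apply: nx; exists x; split=> //.
  exact: power_relation_root rel Ux Vx.
- apply: cop => x Vx Wx; apply: nx; exists x; split=> //.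
  exact: power_relation_root rel2 Vx Wx.
- apply: cop => x Wx Ux; apply: nx; exists x; split=> //.
  exact: power_relation_root rel3 Wx Ux.
exists 1; exists (U ^+ p)`_0, (V ^+ q)`_0, (W ^+ r)`_0.
by split; rewrite alg_polyC; apply: size1_polyC.
Qed.

End PowerRelation.

(** * Regular functions on spaces with functions *)

Lemma set_type_openP (T : topologicalType) (A : set T) (W : set (set_type A)) :
  open W <-> exists2 B : set T, open B & set_val @^-1` B = W.
Proof. by []. Qed.

Lemma open_set_val_image (T : topologicalType) (A : set T) (W : set (set_type A)) :
  open A -> open W -> open (set_val @` W).
Proof.
move=> oA /set_type_openP[B oB <-].
have -> : set_val @` ((set_val : A -> T) @^-1` B) = A `&` B; last exact: openI.
apply/seteqP; split=> x.
  by move=> [y By <-]; split => //; exact: set_valP.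
by move=> [Ax Bx]; exists (SigSub (mem_set Ax)).
Qed.

Section PolynomialEvaluation.
Variables (k : fieldType) (n : nat).
Implicit Types (p q : {mpoly k[n]}) (z : zspace k n).

Lemma pevalC (c : k) z : peval c%:MP z = c.
Proof. by rewrite /peval mevalC. Qed.

Lemma pevalD p q z : peval (p + q) z = peval p z + peval q z.
Proof. by rewrite /peval mevalD. Qed.

Lemma pevalM p q z : peval (p * q) z = peval p z * peval q z.
Proof. by rewrite /peval mevalM. Qed.

End PolynomialEvaluation.

Lemma zero_locus0 (k : fieldType) n (z : zspace k n) : zero_locus set0 z.
Proof. by []. Qed.

Definition apoint (k : fieldType) n (z : zspace k n) : affine_space k n :=
  SigSub (mem_set (zero_locus0 z)).

Section FunctionSpaces.
Variables (k : fieldType) (X : fspace k).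
Hypotheses (shX : sheaf_of_functions X).

Lemma regular_sub1 (U : set X) (f g : X -> k) : open U ->
  regular_on U f -> regular_on U g -> regular_on U (fun x => f x - g x).
Proof.
move=> oU rf rg; have -> : (fun x => f x - g x) = (fun x => f x + (- 1) * g x).
  by apply: funext => x; rewrite mulN1r.
by apply: regular_add => //; apply: regular_mul => //; apply: regular_cst.
Qed.

Lemma regular_exp (U : set X) (f : X -> k) n : open U ->
  regular_on U f -> regular_on U (fun x => f x ^+ n).
Proof.
move=> oU rf; elim: n => [|n IH].
  rewrite (_ : (fun x => _) = fun=> 1); first exact: regular_cst.
  by apply: funext => x; rewrite expr0.
rewrite (_ : (fun x => _) = fun x => f x * f x ^+ n); first exact: regular_mul.
by apply: funext => x; rewrite exprS.
Qed.

Lemma regular_sum (U : set X) (J : Type) (s : seq J) (f : J -> X -> k) : open U ->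
  (forall j, regular_on U (f j)) -> regular_on U (fun x => \sum_(j <- s) f j x).
Proof.
move=> oU rf; elim: s => [|j s IH].
  rewrite (_ : (fun x => _) = fun=> 0); first exact: regular_cst.
  by apply: funext => x; rewrite big_nil.
rewrite (_ : (fun x => _) = fun x => f j x + \sum_(j <- s) f j x).
  exact: regular_add.
by apply: funext => x; rewrite big_cons.
Qed.

(** The sheaf axioms give openness of the locus where a regular function is
invertible. *)
Lemma regular_zero_closed (f : X -> k) :
  regular_on setT f -> closed [set x | f x = 0].
Proof.
move=> rf; rewrite -openC.
have [+ _] := regular_inv shX openT rf.
suff -> : [set x | setT x /\ f x != 0] = ~` [set x | f x = 0] by [].
by apply/seteqP; split=> x /=; [move=> [_ /eqP]|move=> /eqP].
Qed.

(** The identity principle: two nonempty open subsets of an irreducible space meet. *)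
Lemma regular_identity (U : set X) (f : X -> k) : irreducible_set [set: X] ->
  open U -> U !=set0 -> regular_on setT f -> (forall x, U x -> f x = 0) ->
  forall x, f x = 0.
Proof.
move=> [_ irr] oU U0 rf fU x; apply: contrapT => fx.
have oN := regular_zero_closed rf; rewrite -openC in oN.
have [||y [_ [/fU fy /(_ fy)]]] // := irr _ _ oU oN.
  by case: U0 => y Uy; exists y.
by exists x.
Qed.

End FunctionSpaces.

(** * Affine algebraic sets and affine space *)

Section AlgebraicSets.
Variables (k : fieldType) (n : nat) (I : set {mpoly k[n]}).
Local Notation X := (alg_set I).
Local Notation ev r x := (peval r (set_val x)).

(** The loci where one polynomial does not vanish form a basis of the Zariski
topology. *)
Lemma alg_set_openP (W : set X) : open W <->
  forall x, W x -> exists2 r : {mpoly k[n]}, ev r x != 0 &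
    forall y : X, ev r y != 0 -> W y.
Proof.
split=> [/set_type_openP[_ [J ->] <-] x /nonzero_locusP[r Jr rx]|Wr].
  by exists r => // y ry; apply/nonzero_locusP; exists r.
pose J : set {mpoly k[n]} := [set r | forall y : X, ev r y != 0 -> W y].
apply/set_type_openP; exists (~` zero_locus J); first by exists J.
apply/seteqP; split=> x /=; first by move=> /nonzero_locusP[r]; apply.
by move=> /Wr[r rx rW]; apply/nonzero_locusP; exists r.
Qed.

(** In this local form the neighbourhood of x is a principal open set contained in
U, so that a regular function can be glued from its restrictions. *)
Lemma regular_alg_setP (U : set X) (f : X -> k) : open U ->
  regular_on U f <-> forall x, U x -> exists r p q : {mpoly k[n]},
    [/\ ev r x != 0, ev q x != 0 & forall y : X, ev r y != 0 -> ev q y != 0 ->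
      U y /\ f y = ev p y / ev q y].
Proof.
move=> oU; split=> rf x Ux.
  have [r rx rU] := (alg_set_openP U).1 oU x Ux.
  have [p [q [qx fE]]] := rf x Ux.
  by exists r, p, q; split=> // y ry qy; split; [exact: rU|apply: fE => //; exact: rU].
have [r [p [q [rx qx fE]]]] := rf x Ux.
exists (p * r), (q * r); rewrite pevalM mulf_neq0//; split=> // y Uy.
rewrite !pevalM mulf_eq0 negb_or => /andP[qy ry]; have [_ ->] := fE y ry qy.
by rewrite -mulf_div divff// mulr1.
Qed.

Lemma alg_set_sheaf : sheaf_of_functions X.
Proof.
split.
- move=> U V f oU oV VU rf x Vx; have [p [q [qx fE]]] := rf x (VU _ Vx).
  by exists p, q; split=> // y /VU; exact: fE.
- move=> U f oU loc; apply/regular_alg_setP => // x Ux.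
  have [V [g [oV Vx VU rg fg]]] := loc x Ux.
  have [r [p [q [rx qx gE]]]] := (regular_alg_setP g oV).1 rg x Vx.
  exists r, p, q; split=> // y ry qy; have [Vy gy] := gE y ry qy.
  by split; [exact: VU | rewrite fg].
- move=> U c oU x Ux; exists c%:MP, 1; rewrite -[1]/(1%:MP) pevalC oner_neq0.
  by split=> // y _ _; rewrite !pevalC divr1.
- move=> U f g oU rf rg x Ux.
  have [p [q [qx fE]]] := rf x Ux; have [p' [q' [qx' gE]]] := rg x Ux.
  exists (p * q' + p' * q), (q * q'); rewrite pevalM mulf_neq0//; split=> // y Uy.
  rewrite pevalM mulf_eq0 negb_or => /andP[qy qy'].
  by rewrite (fE y)// (gE y)// addf_div// pevalD !pevalM.
- move=> U f g oU rf rg x Ux.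
  have [p [q [qx fE]]] := rf x Ux; have [p' [q' [qx' gE]]] := rg x Ux.
  exists (p * p'), (q * q'); rewrite pevalM mulf_neq0//; split=> // y Uy.
  rewrite pevalM mulf_eq0 negb_or => /andP[qy qy'].
  by rewrite (fE y)// (gE y)// mulf_div !pevalM.
- move=> U f oU rf; split.
    apply/alg_set_openP => x [Ux fx].
    have [r [p [q [rx qx fE]]]] := (regular_alg_setP f oU).1 rf x Ux.
    have [_ fxE] := fE x rx qx.
    have px : ev p x != 0 by apply: contraNneq fx; rewrite fxE => ->; rewrite mul0r.
    exists (r * q * p) => [|y]; first by rewrite !pevalM !mulf_neq0.
    rewrite !pevalM !mulf_eq0 !negb_or => /andP[/andP[ry qy] py].
    have [Uy fy] := fE y ry qy.
    by split=> //; rewrite fy mulf_neq0 ?invr_eq0.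
  move=> x [Ux fx]; have [p [q [qx fE]]] := rf x Ux.
  have px : ev p x != 0 by apply: contraNneq fx; rewrite (fE x)// => ->; rewrite mul0r.
  exists (q * q), (p * q); rewrite pevalM mulf_neq0//; split=> // y [Uy fy].
  rewrite pevalM mulf_eq0 negb_or => /andP[py qy]; rewrite (fE y)// pevalM.
  by rewrite invf_div -mulf_div divff// mulr1.
Qed.

Lemma coordinate_regular (i : 'I_n) :
  regular_on [set: X] (fun x => (set_val x : zspace k n) i).
Proof.
move=> x _; exists 'X_i, 1; rewrite /peval meval1 oner_neq0; split=> // y _ _.
by rewrite mevalXU meval1 divr1.
Qed.

Lemma alg_set_ext (x y : X) :
  (forall i, (set_val x : zspace k n) i = (set_val y : zspace k n) i) -> x = y.
Proof. by move=> e; apply/val_inj/ffunP. Qed.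

Lemma alg_set_point_closed (a : X) : closed [set a].
Proof.
rewrite -openC; apply/alg_set_openP => x xa.
have [i xi] : exists i, (set_val x : zspace k n) i != (set_val a : zspace k n) i.
  apply: contrapT => ne; apply: xa; apply: alg_set_ext => i.
  by apply/eqP/negPn/negP => xi; apply: ne; exists i.
exists ('X_i - ((set_val a : zspace k n) i)%:MP) => [|y].
  by rewrite /peval mevalB mevalXU mevalC subr_eq0.
by rewrite /peval mevalB mevalXU mevalC => + ya; rewrite -ya subrr eqxx.
Qed.

End AlgebraicSets.

(** Two morphisms agree where all the coordinates of their values agree, and the
coordinates are regular functions. *)
Lemma alg_set_separated (k : fieldType) n (I : set {mpoly k[n]}) :
  separated_fspace (alg_set I).
Proof.
move=> m J f g mf mg; have shJ := alg_set_sheaf J.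
pose c i x := (set_val (x : alg_set I) : zspace k n) i.
have -> : [set z | f z = g z] =
    \bigcap_(i in [set: 'I_n]) [set z | c i (f z) - c i (g z) = 0].
  apply/seteqP; split=> z /=; first by move=> e i _ /=; rewrite e subrr.
  move=> e; apply: alg_set_ext => i; apply/eqP; rewrite -subr_eq0; apply/eqP.
  exact: e i Logic.I.
apply: closed_bigI => i _; apply: (regular_zero_closed shJ).
apply: (regular_sub1 shJ); first exact: openT.
- exact: mf.2 setT (c i) openT (coordinate_regular (I := I) i).
- exact: mg.2 setT (c i) openT (coordinate_regular (I := I) i).
Qed.

Lemma isomorphic_refl (k : fieldType) (X : fspace k) : isomorphic X X.
Proof.
have mid : is_morphism (@id X) by split=> // x.
by exists id, id.
Qed.

Lemma open_subspace_setT (k : fieldType) (X : fspace k) : sheaf_of_functions X ->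
  isomorphic (open_subspace [set: X]) X.
Proof.
move=> shX; pose v : open_subspace [set: X] -> X := set_val.
pose w (x : X) : open_subspace [set: X] := SigSub (mem_set (I : [set: X] x)).
exists v, w; split.
- split=> [|V phi oV rphi].
    by apply/continuousP => A oA; apply/set_type_openP; exists A.
  exists phi => //; apply: (regular_sub shX oV) rphi.
    apply: open_set_val_image; first exact: openT.
    by apply/set_type_openP; exists V.
  by move=> _ [y Vy <-].
- have cw : continuous w.
    by apply/continuousP => _ [B oB <-]; exact: oB.
  split=> // V phi oV [g rg phiE].
  have oW : open (w @^-1` V) by move/continuousP: cw; apply.
  apply: (regular_local shX) => // x Vx.
  exists (w @^-1` V), g; split=> // [|y Vy /=]; last by rewrite phiE.
  apply: (regular_sub shX _ oW) rg => [|y Vy]; last by exists (w y).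
  by apply: open_set_val_image => //; exact: openT.
- by move=> x; apply/val_inj.
- by [].
Qed.

Lemma alg_set_locally_affine (k : fieldType) n (I : set {mpoly k[n]}) :
  locally_affine (alg_set I).
Proof.
exists 1, (fun=> setT); split=> [_|x|_]; [exact: openT|by exists 0|].
by exists n, I; apply: open_subspace_setT; exact: alg_set_sheaf.
Qed.

Section AffineSpace.
Variables (K : numFieldType) (n : nat).

(** Two nonzero polynomials have a nonzero product, which does not vanish at some
point. *)
Lemma affine_space_irreducible : irreducible_set [set: affine_space K n].
Proof.
split; first by exists (apoint [ffun=> 0]).
move=> U V oU oV [x [_ Ux]] [y [_ Vy]].
have [r rx rU] := (alg_set_openP U).1 oU x Ux.
have [s sy sV] := (alg_set_openP V).1 oV y Vy.
have rs0 : r * s != 0.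
  by apply: mulf_neq0; [move: rx|move: sy]; apply: contraNneq => ->;
    rewrite /peval meval0.
have [z] : exists z, (r * s).@[z] != 0.
  apply: contrapT => ne; move/eqP: rs0; apply; apply: mpoly_vanishing => z.
  by apply/eqP/negPn/negP => rsz; apply: ne; exists z.
have zE u : u.@[z] = peval u [ffun i => z i].
  by apply: meval_eq => i; rewrite ffunE.
rewrite zE pevalM mulf_eq0 negb_or => /andP[rz sz].
by exists (apoint [ffun i => z i]); split=> //; split; [exact: rU|exact: sV].
Qed.

Lemma affine_space_variety : variety (affine_space K n).
Proof.
split; [exact: alg_set_sheaf | exact: affine_space_irreducible
  | exact: alg_set_locally_affine | exact: alg_set_separated].
Qed.

Lemma affine_space_rational : is_rational (affine_space K n).
Proof.
have [T0 _] := affine_space_irreducible.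
exists n, setT, setT; split=> //; try exact: openT; exact: isomorphic_refl.
Qed.

End AffineSpace.

Lemma affine_space_positive_dimensional (K : numFieldType) n :
  positive_dimensional (affine_space K n.+1).
Proof.
pose o : affine_space K n.+1 := apoint [ffun=> 0].
exists [set o], setT; split.
- exact: alg_set_point_closed.
- split; first by exists o.
  by move=> U V _ _ [_ [-> Uo]] [_ [-> Vo]]; exists o.
- exact: closedT.
- exact: affine_space_irreducible.
- split=> // /(_ (apoint [ffun=> 1]) I) /(congr1 (fun x : affine_space K n.+1 =>
    (set_val x : zspace K n.+1) ord0)).
  by rewrite !ffunE => /eqP; rewrite oner_eq0.
Qed.

(** * Rational curves in a rational variety *)

Definition line_restriction (k : fieldType) n (a b : 'I_n -> k)
    (p : {mpoly k[n]}) : {poly k} :=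
  mmap polyC (fun i => (a i)%:P + (b i - a i) *: 'X) p.

Lemma horner_line_restriction (k : fieldType) n (a b : 'I_n -> k) p x :
  (line_restriction a b p).[x] = p.@[fun i => a i + (b i - a i) * x].
Proof.
rewrite mevalE /line_restriction /mmap horner_sum; apply: eq_bigr => m _.
rewrite hornerM hornerC horner_prod; congr (_ * _); apply: eq_bigr => i _.
by rewrite horner_exp hornerD hornerC hornerZ hornerX.
Qed.

(** Finitely many regular functions are given near a by fractions with the same
denominator q. The polynomial q is also a multiple of an equation of the
complement of W, so that its nonvanishing is enough to be in W. *)
Lemma common_denominator (k : fieldType) (n m : nat) (W : set (affine_space k n)) a
    (f : 'I_m -> affine_space k n -> k) :
  open W -> W a -> (forall j, regular_on W (f j)) ->
  exists (q : {mpoly k[n]}) (p : 'I_m -> {mpoly k[n]}),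
    peval q (set_val a) != 0 /\
    forall z, peval q z != 0 ->
      W (apoint z) /\ forall j, f j (apoint z) = peval (p j) z / peval q z.
Proof.
move=> oW Wa rf; have [r ra rW] := (alg_set_openP W).1 oW a Wa.
have /choice[p /choice[q pq]] j := rf j a Wa.
exists (r * \prod_j q j), (fun j => p j * r * \prod_(l | l != j) q l).
have pevp (P : pred 'I_m) z :
    peval (\prod_(j | P j) q j) z = \prod_(j | P j) peval (q j) z.
  by rewrite /peval rmorph_prod.
split=> [|z]; rewrite pevalM pevp mulf_eq0 negb_or.
  by rewrite ra; apply/prodf_neq0 => j _; case: (pq j).
move=> /andP[rz /prodf_neq0 qz]; split=> [|j]; first exact: (rW (apoint z) rz).
have [_ /(_ (apoint z) (rW (apoint z) rz) (qz j isT)) ->] := pq j.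
rewrite !pevalM pevp (bigD1 j (P := xpredT))//=.
have : \prod_(l | l != j) peval (q l) z != 0 by apply/prodf_neq0 => l _; apply: qz.
move: (peval (p j) z) (peval (q j) z) (qz j isT) (\prod_(l | _) _).
move: (peval r z) rz => u u0 v w w0 x x0.
by field; rewrite u0 x0 w0.
Qed.

Section RationalCurves.
Variables (k : fieldType) (X : fspace k).
Hypotheses (shX : sheaf_of_functions X) (ratX : is_rational X).

(** In an open subset isomorphic to an open subset of affine space, the line through
the images of s and t, at the parameters 0 and 1, is a rational curve. On it
finitely many regular functions become fractions of one-variable polynomials,
and all but finitely many of its points lie in the variety. *)
Lemma rational_curves (m : nat) (f : 'I_m -> X -> k) :
  (forall j, regular_on setT (f j)) ->
  exists U : set X, [/\ open U, U !=set0 & forall s, U s ->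
    exists V : set X, [/\ open V, V !=set0 & forall t, V t ->
      exists (q : {poly k}) (p : 'I_m -> {poly k}),
        [/\ q.[0] != 0, q.[1] != 0,
            forall j, f j s = (p j).[0] / q.[0],
            forall j, f j t = (p j).[1] / q.[1]
          & forall x, q.[x] != 0 ->
              exists y, forall j, f j y = (p j).[x] / q.[x]]]].
Proof.
move=> rf; have [n [U [V [oU U0 oV V0 [phi [psi [mphi mpsi phiK psiK]]]]]]] := ratX.
exists U; split => // s Us.
pose s' : open_subspace U := SigSub (mem_set Us).
pose vU : open_subspace U -> X := set_val.
pose vV : open_subspace V -> affine_space k n := set_val.
pose W := vV @` (psi @^-1` setT).
have oW : open W.
  by apply: open_set_val_image => //; rewrite preimage_setT; exact: openT.
have /choice[g rg] j : exists g : affine_space k n -> k,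
    regular_on W g /\ forall y, f j (vU (psi y)) = g (vV y).
  have rj : @regular_on k (open_subspace U) setT (f j \o vU).
    exists (f j) => //; apply: (regular_sub shX openT) (rf j) => //.
    by apply: open_set_val_image => //; exact: openT.
  have [g rg gE] := mpsi.2 _ _ openT rj.
  by exists g; split=> // y; rewrite -gE.
have [|q [p [qs qz]]] :=
    @common_denominator k n m W (vV (phi s')) g oW _ (fun j => (rg j).1).
  by exists (phi s').
pose a := set_val (vV (phi s')).
pose D : set (open_subspace V) := [set z | peval q (set_val (vV z)) != 0].
have oD : open D.
  apply/set_type_openP; exists [set z | peval q (set_val z) != 0] => //.
  apply/set_type_openP; exists [set z | peval q z != 0] => //.
  exists [set q]; apply/seteqP; split=> z /=.
    by move=> qz0; apply/nonzero_locusP; exists q.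
  by move=> /nonzero_locusP[_ ->].
exists (vU @` (phi @^-1` D)); split.
- by apply: open_set_val_image => //; move/continuousP: (mphi.1); exact.
- by exists (vU s'); exists s'.
move=> _ [t Dt <-]; pose b := set_val (vV (phi t)).
have fE (y : open_subspace V) j : peval q (set_val (vV y)) != 0 ->
    f j (vU (psi y)) = peval (p j) (set_val (vV y)) / peval q (set_val (vV y)).
  move=> /qz[_ /(_ j) <-]; rewrite (rg j).2; congr (g j _).
  by apply/val_inj.
exists (line_restriction a b q), (fun j => line_restriction a b (p j)).
have end0 u : (line_restriction a b u).[0] = peval u a.
  by rewrite horner_line_restriction; apply: meval_eq => i; rewrite mulr0 addr0.
have end1 u : (line_restriction a b u).[1] = peval u b.
  rewrite horner_line_restriction; apply: meval_eq => i.
  by rewrite mulr1 addrC subrK.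
split.
- by rewrite end0.
- by rewrite end1.
- by move=> j; rewrite !end0 -fE// phiK.
- by move=> j; rewrite !end1 -fE// phiK.
move=> x; rewrite !horner_line_restriction => qx.
pose c : zspace k n := [ffun i => a i + (b i - a i) * x].
have cE u : peval u c = u.@[fun i => a i + (b i - a i) * x].
  by apply: meval_eq => i; rewrite ffunE.
have /qz[[y _ yc] cz] : peval q c != 0 by rewrite cE.
exists (vU (psi y)) => j; rewrite (rg j).2 yc cz horner_line_restriction.
by rewrite !cE.
Qed.

End RationalCurves.

(** * Quasi-toric relations between regular functions *)

(** Cross-multiplication for values taken at two points: u and v are nonzero
denominators there, and g and g' the values of a common factor. *)
Lemma proportional_cross (K : fieldType) (x x' y y' u v e e' g g' : K) :
  u != 0 -> v != 0 -> x * u = e * g -> x' * v = e * g' ->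
  y * u = e' * g -> y' * v = e' * g' -> x * y' = x' * y.
Proof.
move=> u0 v0 xu xv yu yv; apply: (mulIf (mulf_neq0 u0 v0)).
have -> : x * y' * (u * v) = (x * u) * (y' * v) by ring.
have -> : x' * y * (u * v) = (x' * v) * (y * u) by ring.
by rewrite xu yv xv yu; ring.
Qed.

Section NoRationalCurve.
Variables (K : numClosedFieldType) (p : 'I_3 -> nat) (d : nat).
Hypotheses (p0 : forall i, (0 < p i)%N).
Hypothesis (dp : forall i j, i != j -> lcmn (p i) (p j) = d).
Hypothesis hyperbolic :
  (p 1%R * p 2%:R + p 0%R * p 2%:R + p 0%R * p 1%R <= p 0%R * p 1%R * p 2%:R)%N.

Lemma poly_quasi_toric_const (a : 'I_3 -> K) (U : 'I_3 -> {poly K}) :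
  (forall i, a i != 0) -> \sum_(i < 3) a i *: U i ^+ p i = 0 ->
  exists (G : {poly K}) (e : 'I_3 -> K), forall i, U i ^+ p i = e i *: G.
Proof.
move=> a0; rewrite sum3E => rel.
have [G [e0 [e1 [e2 [E0 E1 E2]]]]] :=
  power_relation_const (p0 0) (p0 1) (p0 2%:R) (@dp 0 1 isT) (@dp 1 2%:R isT)
   (@dp 2%:R 0 isT) hyperbolic (a0 0) (a0 1) (a0 2%:R) rel.
exists G, (fun i : 'I_3 => if i == 0 then e0 else if i == 1 then e1 else e2).
exact: forall3.
Qed.

Variable X : fspace K.
Hypotheses (shX : sheaf_of_functions X) (ratX : is_rational X).
Hypothesis (irrX : irreducible_set [set: X]).

Lemma exponent_divK i : (d %/ p i * p i)%N = d.
Proof.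
rewrite divnK//; have [j ij] : exists j, i != j.
  by case: (eqVneq i 0) => [->|]; [exists 1 | exists 0].
by rewrite -(dp ij) dvdn_lcml.
Qed.

(** Along a rational curve with denominator q, the polynomials P_l q^(d/p_l - 1)
satisfy the same relation as the functions f_l, multiplied by q^d. The identity
proved on pairs of nearby points extends to t, and then to s, by the identity
principle. *)
Lemma regular_quasi_toric_const (a : 'I_3 -> K) (f : 'I_3 -> X -> K) :
  (forall i, a i != 0) -> (forall i, regular_on setT (f i)) ->
  (forall t, \sum_(i < 3) a i * f i t ^+ p i = 0) ->
  forall s t i j, f i s ^+ p i * f j t ^+ p j = f i t ^+ p i * f j s ^+ p j.
Proof.
move=> a0 rf rel.
have d0 i : (0 < d %/ p i)%N.
  have := exponent_divK i; case: (d %/ p i)%N => //; rewrite mul0n => /esym.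
  have := @dp 0 1 isT => <- /eqP; rewrite -leqn0 leqNgt lcmn_gt0 !p0.
  by [].
have [U [oU U0 UP]] := rational_curves shX ratX rf.
pose h i j s t := f i s ^+ p i * f j t ^+ p j - f i t ^+ p i * f j s ^+ p j.
have reg i j s : regular_on setT (h i j s).
  have oT : open [set: X] by exact: openT.
  apply: (regular_sub1 shX oT); apply: (regular_mul shX oT);
    by [exact: (regular_cst shX) | apply: (regular_exp shX)].
have hU i j s : U s -> forall t, h i j s t = 0.
  move=> /UP[V [oV V0 VP]]; apply: (regular_identity shX irrX oV V0 (reg i j s)).
  move=> t /VP[q [P [q0 q1 fs ft fx]]] {VP}.
  (* The value of W_l is that of f_l times q^(d / p_l), since P_l is f_l times q. *)
  pose W l := P l * q ^+ (d %/ p l).-1.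
  have WE l x y : q.[x] != 0 -> f l y = (P l).[x] / q.[x] ->
      (W l).[x] ^+ p l = f l y ^+ p l * q.[x] ^+ d.
    move=> qx fE; rewrite hornerM horner_exp.
    have -> : (P l).[x] = f l y * q.[x] by rewrite fE divfK.
    by rewrite -mulrA -exprS prednK// exprMn -exprM exponent_divK.
  have relW : \sum_(l < 3) a l *: W l ^+ p l = 0.
    (* The relation holds where q does not vanish; multiplying by q makes it hold
    everywhere. *)
    have qn0 : q != 0 by apply: contraNneq q0 => ->; rewrite horner0.
    apply: (mulfI qn0); rewrite mulr0; apply: poly_vanishing => x.
    rewrite hornerM; have [->|qx] := eqVneq q.[x] 0; first by rewrite mul0r.
    have [y fy] := fx _ qx; rewrite horner_sum.
    under eq_bigr => l _ do rewrite hornerZ horner_exp (WE l x y qx (fy l)) mulrA.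
    by rewrite -mulr_suml rel mul0r mulr0.
  have [G [e WG]] := poly_quasi_toric_const a0 relW.
  have E0 l : f l s ^+ p l * q.[0] ^+ d = e l * G.[0].
    by rewrite -(WE l 0 s q0 (fs l)) -horner_exp WG hornerZ.
  have E1 l : f l t ^+ p l * q.[1] ^+ d = e l * G.[1].
    by rewrite -(WE l 1 t q1 (ft l)) -horner_exp WG hornerZ.
  apply/eqP; rewrite subr_eq0; apply/eqP.
  exact: (proportional_cross (expf_neq0 d q0) (expf_neq0 d q1)
    (E0 i) (E1 i) (E0 j) (E1 j)).
(* The identity is symmetric in s and t, so the identity principle applies to both. *)
have sym i j s t : h j i t s = h i j s t by rewrite /h; congr (_ - _); rewrite mulrC.
move=> s t i j; apply/eqP; rewrite -subr_eq0; apply/eqP; rewrite -/(h i j s t).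
rewrite -sym; apply: (regular_identity shX irrX oU U0 (reg j i t)) => x Ux.
by rewrite sym hU.
Qed.

End NoRationalCurve.

(** * Arithmetic of reduced types *)

Local Open Scope nat_scope.

Lemma gcdn_mul_dvd a b c : gcdn c (a * b) %| gcdn c a * gcdn c b.
Proof.
rewrite muln_gcdr !muln_gcdl !dvdn_gcd.
have xc := dvdn_gcdl c (a * b); have xab := dvdn_gcdr c (a * b).
by rewrite xab (dvdn_mulr c xc) (dvdn_mulr b xc) (dvdn_mull a xc).
Qed.

(** If no prime divides a, b and c, then gcd(c, a) and gcd(c, b) are coprime, and
gcd(c, a b) divides their product. *)
Lemma reduction_dvd g a b c : gcdn (gcdn a b) c = 1 ->
  g * gcdn c (a * b) %| lcmn (g * gcdn a (b * c)) (g * gcdn b (a * c)).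
Proof.
move=> abc; rewrite -muln_lcmr dvdn_mul// (dvdn_trans (gcdn_mul_dvd a b c))//.
rewrite Gauss_dvd; last by rewrite /coprime gcdnACA gcdnn gcdnC abc.
apply/andP; split.
  apply: dvdn_trans (dvdn_lcml _ _).
  by rewrite dvdn_gcd dvdn_gcdr dvdn_mull// dvdn_gcdl.
apply: dvdn_trans (dvdn_lcmr _ _).
by rewrite dvdn_gcd dvdn_gcdr dvdn_mull// dvdn_gcdl.
Qed.

Section ReducedTypes.
Variable p : 'I_3 -> nat.
Hypothesis p_red : reduced_type p.

Lemma reduced_type_gt0 i : 0 < p i.
Proof.
have [p' p'0 ->] := p_red; rewrite /reduction.
set g := \big[gcdn/0]_(j < 3) p' j.
have gi : g %| p' i by apply: biggcdn_inf (dvdnn _).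
have g0 : 0 < g by apply: dvdn_gt0 gi.
by rewrite muln_gt0 g0 gcdn_gt0 divn_gt0// dvdn_leq.
Qed.

Lemma reduced_type_dvd : [/\ p 0%R %| lcmn (p 1%R) (p 2%R),
  p 1%R %| lcmn (p 0%R) (p 2%R) & p 2%R %| lcmn (p 0%R) (p 1%R)].
Proof.
have [p' p'0 ->] := p_red; rewrite /reduction.
set g := \big[gcdn/0]_(j < 3) p' j.
have gi i : g %| p' i by apply: biggcdn_inf (dvdnn _).
have g0 : 0 < g by apply: dvdn_gt0 (gi 0%R).
pose a i := p' i %/ g.
have aE i : p' i = g * a i by rewrite mulnC divnK.
have gE : g = gcdn (gcdn (p' 0%R) (p' 1%R)) (p' 2%R) by rewrite /g big3.
have a1 : gcdn (gcdn (a 0%R) (a 1%R)) (a 2%R) = 1.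
  apply/eqP; rewrite -(eqn_pmul2l g0) muln1 !muln_gcdr -!aE; exact/eqP.
have prodE i x y : \prod_(j < 3 | j != i) p' j = p' x * p' y ->
    (\prod_(j < 3 | j != i) p' j) %/ g ^ 2 = a x * a y.
  by move=> ->; rewrite !aE mulnACA -[g * g]/(g ^ 2) mulnC mulnK// expn_gt0 g0.
have e0 : \prod_(j < 3 | j != 0%R) p' j = p' 1%R * p' 2%R.
  by rewrite big_mkcond big3 /= mul1n.
have e1 : \prod_(j < 3 | j != 1%R) p' j = p' 0%R * p' 2%R.
  by rewrite big_mkcond big3 /= muln1.
have e2 : \prod_(j < 3 | j != 2%R) p' j = p' 0%R * p' 1%R.
  by rewrite big_mkcond big3 /= muln1.
rewrite (prodE _ _ _ e0) (prodE _ _ _ e1) (prodE _ _ _ e2) -!/(a _).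
split.
- rewrite (mulnC (a 0%R) (a 2%R)) (mulnC (a 0%R) (a 1%R)).
  by apply: reduction_dvd; rewrite gcdnC gcdnA.
- rewrite (mulnC (a 1%R) (a 2%R)).
  by apply: reduction_dvd; rewrite -gcdnA (gcdnC (a 2%R)) gcdnA.
- exact: reduction_dvd.
Qed.

(** For each prime, the two largest of its exponents in p_0, p_1, p_2 are equal. *)
Lemma reduced_type_lcm i j : i != j -> lcmn (p i) (p j) = \big[lcmn/1]_(l < 3) p l.
Proof.
have [/lcmn_idPr d0 /lcmn_idPr d1 /lcmn_idPl d2] := reduced_type_dvd.
rewrite big3 /= d2; move: i j.
have e01 : lcmn (p 0%R) (p 2%R) = lcmn (p 0%R) (p 1%R) by rewrite -d1 lcmnCA lcmnA d2.
have e02 : lcmn (p 1%R) (p 2%R) = lcmn (p 0%R) (p 1%R) by rewrite -d0 lcmnA d2.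
by apply: forall3; apply: forall3 => //; rewrite lcmnC.
Qed.

End ReducedTypes.

(** The condition 1/p + 1/q + 1/r > 1 leaves (2,2,r), (2,3,3), (2,3,4) and (2,3,5),
of which the divisibilities keep only (2,2,2). *)
Lemma hyperbolic_exponents p q r : 1 < p -> p <= q <= r ->
  p %| lcmn q r -> r %| lcmn p q -> [/\ p = 2, q = 2 & r = 2] \/
  q * r + p * r + p * q <= p * q * r.
Proof.
move=> p1 /andP[pq qr] dp dr; have [p2|p3] := leqP p 2; last first.
  right; have h1 : p * r <= q * r by rewrite leq_mul.
  have h2 : p * q <= q * r by rewrite mulnC leq_mul2l (leq_trans pq qr) orbT.
  have : 3 * (q * r) <= p * q * r by rewrite -mulnA leq_mul.
  lia.
have {p2 p1} pE : p = 2 by lia.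
subst p; have [q2|q3] := leqP q 2.
  have qE : q = 2 by lia.
  subst q; left; split=> //; apply/eqP; rewrite eqn_leq qr andbT.
  by apply: dvdn_leq dr.
right; have [q4|q4] := ltnP 3 q; last first.
  have qE : q = 3 by lia.
  subst q; have r6 : r <= 6 by apply: dvdn_leq dr.
  move: dp dr; have [->|[->|[->|->]]] // : r = 3 \/ r = 4 \/ r = 5 \/ r = 6 by lia.
have := leq_mul q4 (leqnn r); lia.
Qed.

(** * Equivalence of quasi-toric relations *)

Local Close Scope nat_scope.

Lemma product_chain (R : comPzRingType) (u u' v v' f g h : R) :
  u * f = v * g -> u' * g = v' * h -> u * u' * f = v * v' * h.
Proof.
by move=> e e'; rewrite -mulrA mulrCA e mulrCA e' mulrA.
Qed.

(** Two elements that are, with the same constant c, related to one h are related to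
each other without c. *)
Lemma scaled_product_chain (K : fieldType) (A : comAlgType K) (c : K)
    (u u' v v' f g h : A) :
  v * f = c *: (u * h) -> v' * g = c *: (u' * h) -> v * u' * f = v' * u * g.
Proof.
move=> e e'; rewrite mulrAC e mulrAC e' -!scalerAl.
by congr (_ *: _); rewrite mulrAC [RHS]mulrAC (mulrC u).
Qed.

Section Forms.
Variable K : fieldType.
Implicit Types f g : {mpoly K[3]}.

Lemma is_form1 : is_form (1 : {mpoly K[3]}).
Proof. by split; [exact: oner_neq0 | exact: homogE (dhomog1 _ _)]. Qed.

Lemma is_formM f g : is_form f -> is_form g -> is_form (f * g).
Proof.
move=> [f0 /homogP[d fd]] [g0 /homogP[e ge]].
by split; [rewrite mulf_neq0 | exact: homogE (dhomogM fd ge)].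
Qed.

Lemma is_formX f n : is_form f -> is_form (f ^+ n).
Proof.
move=> ff; elim: n => [|n IH]; first by rewrite expr0; exact: is_form1.
by rewrite exprS; apply: is_formM.
Qed.

Lemma qt_equiv_refl (p : 'I_3 -> nat) (h : 'I_3 -> {mpoly K[3]}) : qt_equiv p h h.
Proof. by exists 1, 1; split=> //; exact: is_form1. Qed.

Lemma qt_equiv_sym (p : 'I_3 -> nat) (g h : 'I_3 -> {mpoly K[3]}) :
  qt_equiv p g h -> qt_equiv p h g.
Proof. by move=> [u [v [fu fv e]]]; exists v, u; split=> // i; rewrite e. Qed.

Lemma qt_equiv_trans (p : 'I_3 -> nat) (f g h : 'I_3 -> {mpoly K[3]}) :
  qt_equiv p f g -> qt_equiv p g h -> qt_equiv p f h.
Proof.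
move=> [u [v [fu fv e]]] [u' [v' [fu' fv' e']]].
exists (u * u'), (v * v'); split=> [||i]; try exact: is_formM.
by rewrite !exprMn; apply: product_chain (e i) (e' i).
Qed.

Lemma qt_class_eqP (p : 'I_3 -> nat) (F g h : 'I_3 -> {mpoly K[3]}) :
  quasi_toric p F h -> qt_class p F g = qt_class p F h <-> qt_equiv p g h.
Proof.
move=> qh; split=> [e|gh].
  have : qt_class p F h h by split=> //; exact: qt_equiv_refl.
  by rewrite -e => -[].
apply/seteqP; split=> x [qx] E; split=> //.
  by apply: qt_equiv_trans E; exact: qt_equiv_sym.
exact: qt_equiv_trans gh E.
Qed.

End Forms.

Section RootsOfUnity.
Variable K : numClosedFieldType.

Lemma unity_roots_list n : (0 < n)%N ->
  exists2 s : seq K, (forall z, (z \in s) = (z ^+ n == 1)) & (0 < size s)%N.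
Proof.
move=> n0; have [s e] := closed_field_poly_normal ('X^n - 1 : {poly K}).
have sE z : (z \in s) = (z ^+ n == 1).
  have <- : root ('X^n - 1 : {poly K}) z = (z ^+ n == 1).
    by rewrite rootE !hornerE subr_eq0.
  by rewrite e (monicP (monicXnsubC 1 n0)) scale1r root_prod_XsubC.
exists s => //; case: s sE {e} => // /(_ 1).
by rewrite expr1n eqxx.
Qed.

(** At every point the value of f is that of g times some n-th root of unity, so the
product of the f - z g over these roots z vanishes everywhere. *)
Lemma mpoly_expr_eq m n (f g : {mpoly K[m]}) : (0 < n)%N ->
  f ^+ n = g ^+ n -> exists2 z : K, z ^+ n = 1 & f = z *: g.
Proof.
move=> n0 fg; have [s sE s0] := unity_roots_list n0.
have : \prod_(z <- s) (f - z *: g) = 0.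
  apply: mpoly_vanishing => x; rewrite rmorph_prod /=; apply/eqP.
  have {fg} : f.@[x] ^+ n = g.@[x] ^+ n by rewrite -!rmorphXn fg.
  have [gx|g0] := eqVneq g.@[x] 0 => e.
    move: e; rewrite gx expr0n gtn_eqF// => /eqP; rewrite expf_eq0 n0 /= => /eqP f0.
    case: s s0 {sE} => // z s _.
    by rewrite big_cons mevalB mevalZ f0 gx mulr0 subrr mul0r.
  have zs : f.@[x] / g.@[x] \in s by rewrite sE expr_div_n e divff ?expf_neq0.
  rewrite prodf_seq_eq0; apply/hasP; exists (f.@[x] / g.@[x]) => //=.
  by rewrite mevalB mevalZ divfK// subrr.
move=> /eqP; rewrite prodf_seq_eq0 => /hasP[z]; rewrite sE /= => /eqP zn.
by rewrite subr_eq0 => /eqP fz; exists z.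
Qed.

End RootsOfUnity.

Section FinitelyManyClasses.
Variables (K : numClosedFieldType) (p : 'I_3 -> nat).
Let d := (\big[lcmn/1]_(j < 3) p j)%N.
Hypotheses (p0 : forall i, (0 < p i)%N).
Hypothesis (dp : lcmn (p 0) (p 1) = d).

Lemma weightK i : (weight p i * p i)%N = d.
Proof. by rewrite divnK// /d (bigD1 i)//= dvdn_lcml. Qed.

(** Let al p_0 = be p_1 + gcd(p_0, p_1) be a Bezout relation, and A = h_0 / g_0,
B = h_1 / g_1. As A^p_0 = B^p_1, this common value is (B^al / A^be)^d. The forms
u and v are the numerator and the denominator of B^al / A^be. *)
Lemma equal_ratios_equiv (h g : 'I_3 -> {mpoly K[3]}) :
  (forall i, is_form (h i)) -> (forall i, is_form (g i)) ->
  (forall i, h 0 ^+ p 0%R * g i ^+ p i = g 0 ^+ p 0%R * h i ^+ p i) ->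
  exists u v (z : 'I_3 -> K), [/\ is_form u, is_form v,
    forall i, z i ^+ p i = 1
    & forall i, v ^+ weight p i * h i = z i *: (u ^+ weight p i * g i)].
Proof.
move=> fh fg hg.
have [al be bezout _] := egcdnP (p 1) (p0 0).
set c := gcdn (p 0) (p 1) in bezout.
have c0 : (0 < c)%N by rewrite gcdn_gt0 p0.
pose p' := (p 0%R %/ c)%N; pose q' := (p 1%R %/ c)%N.
have pE : p 0 = (p' * c)%N by rewrite divnK ?dvdn_gcdl.
have qE : p 1 = (q' * c)%N by rewrite divnK ?dvdn_gcdr.
have dE : d = (p' * p 1%R)%N by rewrite -dp /lcmn -/c divn_mulAC// dvdn_gcdl.
have dE' : d = (q' * p 0%R)%N by rewrite dE pE qE; lia.
(* The Bezout relation divided by the gcd; p' and q' are d / p_1 and d / p_0. *)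
have bz : (al * p' = be * q' + 1)%N.
  apply/eqP; rewrite -(eqn_pmul2r c0) mulnDl mul1n -!mulnA -pE -qE bezout.
  by [].
pose u := h 1 ^+ al * g 0 ^+ be; pose v := g 1 ^+ al * h 0 ^+ be.
have key : h 0 ^+ p 0%R * v ^+ d = g 0 ^+ p 0%R * u ^+ d.
  have al1 : (al * d = p 1%R * (al * p'))%N by rewrite dE; lia.
  have be1 : (p 0%R + be * d = p 0%R * (al * p'))%N by rewrite bz dE'; lia.
  move: (al * p')%N al1 be1 => X al1 be1.
  have E (x y : {mpoly K[3]}) : x ^+ p 0%R * (y ^+ al * x ^+ be) ^+ d =
      (x ^+ p 0%R * y ^+ p 1%R) ^+ X.
    rewrite !exprMn -!exprM al1 mulrCA -exprD be1; exact: mulrC.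
  by rewrite /u /v !E hg.
have fu : is_form u by apply: is_formM; apply: is_formX.
have fv : is_form v by apply: is_formM; apply: is_formX.
clearbody u v.
have eqp i : (v ^+ weight p i * h i) ^+ p i = (u ^+ weight p i * g i) ^+ p i.
  rewrite !exprMn -!exprM weightK.
  apply: (mulfI (expf_neq0 (p 0%R) (fg 0).1)).
  transitivity (v ^+ d * (g 0 ^+ p 0%R * h i ^+ p i)); first exact: mulrCA.
  by rewrite -hg mulrCA !mulrA key.
have /choice[z zP] i : exists y, y ^+ p i = 1 /\
    v ^+ weight p i * h i = y *: (u ^+ weight p i * g i).
  by have [y] := mpoly_expr_eq (p0 i) (eqp i); exists y.
exists u, v, z; split.
- by [].
- by [].
- by move=> i; case: (zP i).
- by move=> i; case: (zP i).
Qed.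

(** All relations of the family are compared with a fixed one, h s. The class of h t
is determined by the three roots of unity of [equal_ratios_equiv], all of which
are d-th roots of unity. *)
Lemma finite_qt_classes (F : 'I_3 -> {mpoly K[3]}) (T : Type)
    (h : T -> 'I_3 -> {mpoly K[3]}) :
  (forall t, quasi_toric p F (h t)) ->
  (forall s t i j, h s i ^+ p i * h t j ^+ p j = h t i ^+ p i * h s j ^+ p j) ->
  finite_set (range (fun t => qt_class p F (h t))).
Proof.
move=> qh cross; have [[s _]|nT] := pselect (exists s : T, True); last first.
  apply: (@sub_finite_set _ _ set0) => // _ [t _ <-].
  by case: nT; exists t.
have fh t i : is_form (h t i) by case: (qh t).
have d0 : (0 < d)%N by rewrite -dp lcmn_gt0 !p0.
have [r rE _] := unity_roots_list K d0.
have /choice[z zP] t : exists z : {ffun 'I_3 -> seq_sub r}, exists u v,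
    [/\ is_form u, is_form v & forall i,
     v ^+ weight p i * h t i = val (z i) *: (u ^+ weight p i * h s i)].
  have [u [v [z [fu fv zp e]]]] := equal_ratios_equiv (fh t) (fh s) (cross t s 0).
  have zr i : z i \in r by rewrite rE -(weightK i) mulnC exprM zp expr1n.
  exists [ffun i => SeqSub (zr i)], u, v; split=> // i.
  by rewrite ffunE e.
have cls t t' : z t = z t' -> qt_class p F (h t) = qt_class p F (h t').
  move=> ztt'; apply/qt_class_eqP => //.
  have [u [v [fu fv e]]] := zP t; have [u' [v' [fu' fv' e']]] := zP t'.
  exists (v * u'), (v' * u); split; try exact: is_formM.
  move=> i; rewrite !exprMn; apply: scaled_product_chain (e i) _.
  by rewrite ztt'; exact: e'.
have /choice[c cP] (w : {ffun 'I_3 -> seq_sub r}) :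
    exists A, forall t, z t = w -> qt_class p F (h t) = A.
  have [[t zt]|nt] := pselect (exists t, z t = w); last first.
    by exists set0 => t zt; case: nt; exists t.
  by exists (qt_class p F (h t)) => t' zt'; apply: cls; rewrite zt zt'.
apply: (@sub_finite_set _ _ (range c)).
  by move=> _ [t _ <-]; exists (z t) => //; rewrite -(cP _ t).
exact/finite_image/finite_finset.
Qed.

End FinitelyManyClasses.

(** * The two cases are necessary *)

Lemma dhomog_msize_le (K : fieldType) (e : nat) (f : {mpoly K[3]}) :
  f \is e.-homog -> (msize f <= e.+1)%N.
Proof.
move=> fe; rewrite msizeE; apply/bigmax_leqP_seq => m mf _.
by rewrite (dhomog_mf fe mf).
Qed.

(** The forms of the family have the same degree e, so their values at x are sums of
a fixed set of coefficients, with constant weights. *)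
Lemma regular_meval (K : fieldType) (X : fspace K) (h : X -> {mpoly K[3]}) e x :
  sheaf_of_functions X -> (forall t, h t \is e.-homog) ->
  (forall m, regular_on [set: X] (fun t => (h t)@_m)) ->
  regular_on [set: X] (fun t => (h t).@[x]).
Proof.
move=> shX he rh; have oT : open [set: X] by exact: openT.
have -> : (fun t => (h t).@[x]) = fun t =>
    \sum_(m : 'X_{1..3 < e.+1}) (h t)@_m * ('X_[m] : {mpoly K[3]}).@[x].
  apply: funext => t; rewrite {1}(mpolywE (dhomog_msize_le (he t))) rmorph_sum /=.
  by apply: eq_bigr => m _; rewrite mevalZ.
apply: (regular_sum shX) => // m.
by apply: (regular_mul shX) => //; exact: (regular_cst shX).
Qed.

(** For each x with F_0(x) F_1(x) F_2(x) nonzero, the values at x of the components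
are regular functions of t with constant ratios; this gives an identity of
polynomials after multiplication by F_0 F_1 F_2. *)
Lemma hyperbolic_no_family (K : numClosedFieldType) (F : 'I_3 -> {mpoly K[3]})
    (p : 'I_3 -> nat) :
  (forall i, is_form (F i)) -> reduced_type p ->
  (p 1%R * p 2%R + p 0%R * p 2%R + p 0%R * p 1%R <= p 0%R * p 1%R * p 2%R)%N ->
  ~ positive_dim_rational_family p F.
Proof.
move=> fF pred hyp [X [h [[[shX irrX _ _] ratX _] [[e he] rh] qh]]]; apply.
have p0 := reduced_type_gt0 pred; have dp := reduced_type_lcm pred.
apply: finite_qt_classes => //; first exact: dp.
move=> s t i j; apply/eqP; rewrite -subr_eq0.
have F0 : F 0 * F 1 * F 2%R != 0 by rewrite !mulf_neq0// (fF _).1.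
apply/eqP/(mulfI F0); rewrite mulr0; apply: mpoly_vanishing => x.
rewrite !(mevalM, mevalB).
have [->|] := eqVneq ((F 0).@[x]) 0; first by rewrite !mul0r.
have [->|] := eqVneq ((F 1).@[x]) 0; first by rewrite mulr0 !mul0r.
have [->|] := eqVneq ((F 2%R).@[x]) 0; first by rewrite mulr0 !mul0r.
move=> Fx2 Fx1 Fx0; have Fx : forall l, (F l).@[x] != 0 by exact: forall3.
pose f l t := (h t l).@[x].
have rf l : regular_on setT (f l) by apply: (regular_meval x shX (e := e l)).
have rel t' : \sum_(l < 3) (F l).@[x] * f l t' ^+ p l = 0.
  have [_ _ /(congr1 (meval x))] := qh t'; rewrite meval0 rmorph_sum /= => E.
  by apply: etrans E; apply: eq_bigr => l _; rewrite mevalM rmorphXn.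
have := regular_quasi_toric_const p0 dp hyp shX ratX irrX Fx rf rel s t i j.
by rewrite /f -!rmorphXn /= => ->; rewrite subrr mulr0.
Qed.

Lemma family_necessary (K : numClosedFieldType) (F : 'I_3 -> {mpoly K[3]})
    (p : 'I_3 -> nat) :
  (forall i, is_form (F i)) -> reduced_type p -> (p 0%R <= p 1%R <= p 2%R)%N ->
  positive_dim_rational_family p F ->
  ([/\ p 0 = 2%N, p 1 = 2%N & p 2%R = 2%N] /\ exists h, quasi_toric p F h) \/
  (p 0 = 1%N /\ ((p 1%R)%:Z %| (degree (F 1%R))%:Z - (degree (F 2%R))%:Z)%Z).
Proof.
move=> fF pred ple fam.
have [h qh] : exists h, quasi_toric p F h.
  have [X [h [[[_ [[t _] _] _ _] _ _] _ qh _]]] := fam.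
  by exists (h t).
have [d0 d1 d2] := reduced_type_dvd pred.
have [p1|p1] := ltnP 1 (p 0); last first.
  have pE : p 0 = 1%N by apply/eqP; rewrite eqn_leq p1 reduced_type_gt0.
  right; split=> //.
  have p12 : p 1 = p 2%R.
    rewrite pE lcm1n in d1; rewrite pE lcm1n in d2.
    by apply/eqP; rewrite eqn_dvd d1 d2.
  have [fh [D FD] _] := qh.
  have deg i : D = (degree (F i) + degree (h i) * p i)%N.
    apply: (dhomog_uniq _ (FD i)).
      by rewrite mulf_neq0 ?expf_neq0 ?(fF i).1 ?(fh i).1.
    have HF f : is_form f -> f \is (degree f).-homog.
      by move=> [_]; rewrite homog_msize.
    by apply: dhomogM; [exact: HF | apply: dhomogMn; exact: HF].
  have E : (degree (F 1%R) + degree (h 1%R) * p 1%R =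
            degree (F 2%R) + degree (h 2%R) * p 1%R)%N.
    by rewrite -deg p12 -deg.
  apply/dvdzP; exists ((degree (h 2%R))%:Z - (degree (h 1))%:Z).
  by rewrite mulrBl -!PoszM; lia.
have [//|hyp] := hyperbolic_exponents p1 ple d0 d2.
  by left; split=> //; exists h.
by case: (hyperbolic_no_family fF pred hyp fam).
Qed.

(** * Families parametrized by the affine line *)

Section AffineLineFamilies.
Variable K : numFieldType.
Implicit Types (H : K -> {mpoly K[3]}) (f : {mpoly K[3]}).

(** Polynomials in t with coefficients in the ring of polynomials in x; the
coefficients of H t are then polynomial functions of t. *)
Definition polynomial_in_parameter H :=
  exists P : {poly {mpoly K[3]}}, forall t, H t = P.[t%:MP].

Lemma param_cst f : polynomial_in_parameter (fun=> f).
Proof. by exists f%:P => t; rewrite hornerC. Qed.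

Lemma param_id : polynomial_in_parameter (fun t => t%:MP).
Proof. by exists 'X => t; rewrite hornerX. Qed.

Lemma param_add H1 H2 : polynomial_in_parameter H1 ->
  polynomial_in_parameter H2 -> polynomial_in_parameter (fun t => H1 t + H2 t).
Proof. by move=> [P HP] [Q HQ]; exists (P + Q) => t; rewrite hornerD HP HQ. Qed.

Lemma param_opp H :
  polynomial_in_parameter H -> polynomial_in_parameter (fun t => - H t).
Proof. by move=> [P HP]; exists (- P) => t; rewrite hornerN HP. Qed.

Lemma param_mul H1 H2 : polynomial_in_parameter H1 ->
  polynomial_in_parameter H2 -> polynomial_in_parameter (fun t => H1 t * H2 t).
Proof. by move=> [P HP] [Q HQ]; exists (P * Q) => t; rewrite hornerM HP HQ. Qed.

Lemma param_exp H n :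
  polynomial_in_parameter H -> polynomial_in_parameter (fun t => H t ^+ n).
Proof. by move=> [P HP]; exists (P ^+ n) => t; rewrite horner_exp HP. Qed.

(** Distinct parameters give distinct classes, so there are infinitely many of them,
one for each natural number in particular. *)
Lemma affine_line_family (F : 'I_3 -> {mpoly K[3]}) (p e : 'I_3 -> nat)
    (h : K -> 'I_3 -> {mpoly K[3]}) :
  (forall t i, h t i \is (e i).-homog) ->
  (forall i, polynomial_in_parameter (fun t => h t i)) ->
  (forall t, quasi_toric p F (h t)) ->
  (forall s t, qt_equiv p (h s) (h t) -> s = t) ->
  positive_dim_rational_family p F.
Proof.
move=> he hP qh inj; pose c (x : affine_space K 1) : K := (set_val x : zspace K 1) 0.
have shX : sheaf_of_functions (affine_space K 1) by exact: alg_set_sheaf.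
have oT : open [set: affine_space K 1] by exact: openT.
exists (affine_space K 1), (h \o c); split=> //.
- split; [exact: affine_space_variety | exact: affine_space_rational
    | exact: affine_space_positive_dimensional].
- split; first by exists e => t i; apply: he.
  move=> i m; have [P PE] := hP i.
  have -> : (fun t => ((h \o c) t i)@_m) =
      fun t => \sum_(j < size P) (P`_j)@_m * c t ^+ j.
    apply: funext => t; rewrite /= PE horner_coef raddf_sum /=.
    apply: eq_bigr => j _.
    by rewrite -rmorphXn /= mulrC mul_mpolyC mcoeffZ mulrC.
  apply: (regular_sum shX _ oT) => j; apply: (regular_mul shX oT).
    exact: (regular_cst shX).
  by apply: (regular_exp shX) => //; exact: coordinate_regular.
- by move=> t; apply: qh.
move=> fin; pose g (n : nat) := qt_class p F (h n%:R).
have gI : injective g.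
  move=> a b /(qt_class_eqP _ (qh _)).1/inj/eqP.
  by rewrite eqr_nat => /eqP.
apply: infinite_nat; rewrite -(eq_finite_set (inj_card_eq (in2W gI))).
apply: sub_finite_set fin => _ [n _ <-].
by exists (apoint [ffun=> n%:R]) => //; rewrite /= /c ffunE.
Qed.

End AffineLineFamilies.

(** * The two cases are sufficient *)

Section Pencils.
Variable K : numFieldType.

Definition moving_line (i : 'I_3) (t : K) : {mpoly K[3]} := t%:MP * 'X_0 + 'X_i.

Lemma moving_line_eval i t x : (moving_line i t).@[x] = t * x 0 + x i.
Proof. by rewrite /moving_line mevalD mevalM mevalC !mevalXU. Qed.

Lemma dhomogXi (i : 'I_3) : ('X_i : {mpoly K[3]}) \is 1.-homog.
Proof. by rewrite dhomogX /= mdeg1. Qed.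

Lemma moving_line_homog i t : moving_line i t \is 1.-homog.
Proof.
by rewrite /moving_line mul_mpolyC dhomogD ?dhomogZ ?dhomogXi.
Qed.

Lemma moving_line_param i : polynomial_in_parameter (moving_line i).
Proof.
by apply: param_add; [apply: param_mul; [exact: param_id|] |]; exact: param_cst.
Qed.

Lemma mpolyXi_neq0 (i : 'I_3) : ('X_i : {mpoly K[3]}) != 0.
Proof.
apply/eqP => /(congr1 (meval (fun=> 1))); rewrite mevalXU meval0 => /eqP.
by rewrite oner_eq0.
Qed.

Lemma moving_line_inj i : injective (moving_line i).
Proof.
move=> s t /addIr /(mulIf (mpolyXi_neq0 0)) /(congr1 (meval (fun=> 0))).
by rewrite !mevalC.
Qed.

(** If y_0 P_j + y_1 Q_j vanished for one choice of the line t x_0 + x_1 and for one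
of s x_0 + x_2, then - y_0 / y_1 would be a fraction Q/P in x_1 / x_0 and also
one in x_2 / x_0, hence constant. But it would take, at x = (1, - t, 1 - s),
where the two lines have values 0 and 1, both the value 0 and another one, which
may be infinite. *)
Lemma moving_line_avoids (J : Type) (y0 y1 : {mpoly K[3]})
    (P Q : J -> {mpoly K[3]} -> {mpoly K[3]} -> {mpoly K[3]})
    (p q : J -> K -> K -> K) :
  (forall j u v x, (P j u v).@[x] = p j u.@[x] v.@[x]) ->
  (forall j u v x, (Q j u v).@[x] = q j u.@[x] v.@[x]) ->
  (forall j, p j 1 0 != 0) -> (forall j, q j 1 0 = 0) -> (forall j, q j 1 1 != 0) ->
  y1 != 0 ->
  exists2 i : 'I_3, i != 0 & forall j t,
    y0 * P j 'X_0 (moving_line i t) + y1 * Q j 'X_0 (moving_line i t) != 0.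
Proof.
move=> PE QE p10 q10 q11 y10; apply: contrapT => none.
have bad i : i != 0 -> exists j t,
    y0 * P j 'X_0 (moving_line i t) + y1 * Q j 'X_0 (moving_line i t) = 0.
  move=> i0; apply: contrapT => nb; apply: none; exists i => // j t.
  by apply/eqP => e; apply: nb; exists j, t.
have [j [t e]] := bad 1 isT; have [j' [s e']] := bad 2%R isT.
set A := P j _ _ in e; set B := Q j _ _ in e.
set A' := P j' _ _ in e'; set B' := Q j' _ _ in e'.
have : A * B' = A' * B.
  apply: (mulfI y10); apply/eqP; rewrite -subr_eq0; apply/eqP.
  transitivity (A * (y0 * A' + y1 * B') - A' * (y0 * A + y1 * B)); first by ring.
  by rewrite e e' !mulr0 subrr.
(* At this point x_0 = 1, the first line has value 0 and the second one value 1. *)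
pose x (i : 'I_3) : K := if i == 0 then 1 else if i == 1 then - t else 1 - s.
move/(congr1 (meval x)); rewrite !mevalM !PE !QE mevalXU !moving_line_eval.
have [-> -> ->] : [/\ x 0 = 1, x 1 = - t & x 2%R = 1 - s] by [].
rewrite !mulr1 subrr addrC subrK q10 mulr0 => /eqP.
by rewrite mulf_eq0 (negPf (p10 j)) (negPf (q11 j')).
Qed.

End Pencils.

Lemma mul_cancel_middle (R : idomainType) (u v h x y : R) :
  h != 0 -> u * (h * x) = v * (h * y) -> u * x = v * y.
Proof. by move=> h0; rewrite !(mulrCA _ h) => /(mulfI h0). Qed.

(** Put y_i = F_i h_i^2, so that y_0 + y_1 + y_2 = 0. The line through the point h of
the conic and the point (u h_0, v h_1, 0) meets the conic again at the point with
coordinates h_i (y_0 chord0 i + y_1 chord1 i), for u, v nonzero forms of the same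
degree. The value at None is the form u y_0 + v y_1, which vanishes when the line
is tangent. *)
Definition chord0 (R : comNzRingType) (j : option 'I_3) (u v : R) : R :=
  match j with
  | Some l => if l == 0 then - u ^+ 2 else
              if l == 1 then u ^+ 2 - (u * v) *+ 2 else u ^+ 2
  | None => u
  end.

Definition chord1 (R : comNzRingType) (j : option 'I_3) (u v : R) : R :=
  match j with
  | Some l => if l == 0 then v ^+ 2 - (u * v) *+ 2 else
              if l == 1 then - v ^+ 2 else v ^+ 2
  | None => v
  end.

Section ConicFamily.
Variables (K : numFieldType) (F h : 'I_3 -> {mpoly K[3]}) (p : 'I_3 -> nat).
Hypotheses (fF : forall i, is_form (F i)) (p2 : forall i, p i = 2%N).
Hypothesis (qh : quasi_toric p F h).

(** The point (u h_0, v h_1, 0) is recovered from the second point of the chord by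
subtracting the multiple of h that has the same last coordinate; hence the
class of the second point determines v / u, that is, the parameter t. *)
Lemma conic_family : positive_dim_rational_family p F.
Proof.
have [fh [D yD] rel] := qh.
pose y i : {mpoly K[3]} := F i * h i ^+ 2.
have {}yD i : y i \is D.-homog by have := yD i; rewrite p2.
have y0 i : y i != 0 by rewrite mulf_neq0 ?expf_neq0 ?(fF i).1 ?(fh i).1.
have {}rel : y 2%R = - (y 0 + y 1).
  by move: rel; rewrite sum3E !p2 => /eqP; rewrite addrC addr_eq0 => /eqP.
have [|||||i i0 nz] := @moving_line_avoids K _ (y 0) (y 1) (@chord0 _) (@chord1 _)
    (@chord0 _) (@chord1 _) _ _ _ _ _ (y0 1).
- move=> [l|//] u v x; move: l; apply: forall3; rewrite /chord0 /=;
  by rewrite ?(mevalB, mevalN, mevalMn, mevalM, rmorphXn).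
- move=> [l|//] u v x; move: l; apply: forall3; rewrite /chord1 /=;
  by rewrite ?(mevalB, mevalN, mevalMn, mevalM, rmorphXn).
- move=> [l|]; last exact: oner_neq0.
  by move: l; apply: forall3;
    rewrite /chord0 /= ?mulr0 ?mul0rn ?subr0 ?expr1n ?oppr_eq0 oner_eq0.
- move=> [l|//]; move: l; apply: forall3;
  by rewrite /chord1 /= ?mulr0 ?mul0rn ?subr0 ?expr0n ?oppr0.
- move=> [l|]; last exact: oner_neq0.
  move: l; apply: forall3; rewrite /chord1 /= ?mulr1 ?expr1n ?oppr_eq0 ?oner_eq0//.
  by rewrite mulr2n opprD addrA subrr sub0r oppr_eq0 oner_eq0.
set l := moving_line i in nz.
pose r j t : {mpoly K[3]} := y 0 * chord0 j 'X_0 (l t) + y 1 * chord1 j 'X_0 (l t).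
have rD j t : r (Some j) t \is (D + 2).-homog.
  have u2 : ('X_0 : {mpoly K[3]}) ^+ 2 \is 2.-homog := dhomogMn 2 (dhomogXi K 0).
  have v2 : l t ^+ 2 \is 2.-homog := dhomogMn 2 (moving_line_homog i t).
  have uv : ('X_0 * l t) *+ 2 \is 2.-homog.
    by apply: rpredMn; exact: dhomogM (dhomogXi K 0) (moving_line_homog i t).
  by apply: rpredD; apply: dhomogM => //; move: j; apply: forall3;
    rewrite /chord0 /chord1 /= ?rpredN ?rpredB.
pose e j := (degree (h j) + (D + 2))%N.
have hD j : h j \is (degree (h j)).-homog by have [_] := fh j; rewrite homog_msize.
have gD t j : h j * r (Some j) t \is (e j).-homog by exact: dhomogM.
apply: (@affine_line_family _ F p e (fun t j => h j * r (Some j) t)) => //.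
- move=> j; apply: param_mul; first exact: param_cst.
  have pu := param_cst ('X_0 : {mpoly K[3]}); have pv := moving_line_param K i.
  by apply: param_add; (apply: param_mul; first exact: param_cst); move: j;
    apply: forall3; rewrite /chord0 /chord1 /= ; repeat first [assumption
     | apply: param_opp | apply: param_add | apply: param_exp | apply: param_mul].
- move=> t; split.
  + move=> j; split; last exact: homogE (gD t j).
    by rewrite mulf_neq0 ?(fh j).1 ?nz.
  + exists (D + (D + 2) * 2)%N => j; rewrite p2 exprMn mulrA.
    exact: dhomogM (yD j) (dhomogMn 2 (rD j t)).
  + have yE j : F j * (h j * r (Some j) t) ^+ p j = y j * r (Some j) t ^+ 2.
      by rewrite p2 exprMn mulrA.
    rewrite sum3E !yE rel; move: (y 0) (y 1) @r {rD gD nz yE} => y0' y1' r.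
    by rewrite /r /chord0 /chord1 /=; ring.
move=> s t [U [V [fU fV E]]].
have w1 j : weight p j = 1%N by rewrite /weight big3 /= !p2.
have {}E j : U * r (Some j) s = V * r (Some j) t.
  have := E j; rewrite w1 !expr1; exact: mul_cancel_middle (fh j).1.
(* Subtracting the multiple r_2 of the point h leaves (u h_0, v h_1, 0), up to the
factor - 2 (u y_0 + v y_1). *)
have d0 x : r (Some 0) x - r (Some 2%R) x = (- ('X_0 * r None x)) *+ 2.
  by rewrite /r /chord0 /chord1 /=; ring.
have d1 x : r (Some 1) x - r (Some 2%R) x = (- (l x * r None x)) *+ 2.
  by rewrite /r /chord0 /chord1 /=; ring.
have two : (2%:R : {mpoly K[3]}) != 0.
  rewrite -(rmorph_nat (@mpolyC 3 K)) /= mpolyC_eq0 pnatr_eq0//.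
have EB : U * r None s = V * r None t.
  apply: (mulfI (mpolyXi_neq0 K 0)); apply: (mulfI two); apply: oppr_inj.
  transitivity (U * (r (Some 0) s - r (Some 2%R) s)); first by rewrite d0; ring.
  by rewrite mulrBr !E -mulrBr d0; ring.
apply: (@moving_line_inj K i).
apply: (mulIf (mulf_neq0 fU.1 (nz None s))); rewrite -/l -/(r None s).
apply: (mulfI two); apply: oppr_inj.
transitivity (U * (r (Some 1) s - r (Some 2%R) s)); first by rewrite d1; ring.
rewrite mulrBr !E -mulrBr d1 EB; ring.
Qed.

End ConicFamily.

Section LinearFamily.
Variables (K : numFieldType) (F : 'I_3 -> {mpoly K[3]}) (p : 'I_3 -> nat).
Hypotheses (fF : forall i, is_form (F i)).
Variable m : nat.
Hypotheses (p0 : p 0 = 1%N) (p1 : p 1 = m.+1%N) (p2 : p 2%R = m.+1%N).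

(** With h_1 = F_0 x_0^(a+1) and h_2 = F_0 x_0^b l_t, the sum of the last two terms
is divisible by F_0^(m+1), and h_0 is its quotient by - F_0. The exponents a and b
adjust the degrees. *)
Lemma linear_family a b :
  (degree (F 1%R) + a * m.+1 = degree (F 2%R) + b * m.+1)%N ->
  positive_dim_rational_family p F.
Proof.
move=> ab.
have FD i : F i \is (degree (F i)).-homog by have [_] := fF i; rewrite homog_msize.
have X0 : ('X_0 : {mpoly K[3]}) != 0 := mpolyXi_neq0 K 0.
have XD n : ('X_0 : {mpoly K[3]}) ^+ n \is n.-homog.
  by rewrite -[X in X.-homog]mul1n; apply: dhomogMn; exact: dhomogXi.
pose y1 : {mpoly K[3]} := F 1 * ('X_0 ^+ a) ^+ m.+1.
pose y2 : {mpoly K[3]} := F 2%R * ('X_0 ^+ b) ^+ m.+1.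
have y20 : y2 != 0 by rewrite mulf_neq0 ?expf_neq0 ?(fF _).1.
set E := (degree (F 1%R) + a * m.+1)%N in ab.
have y1D : y1 \is E.-homog by apply: dhomogM (FD 1) (dhomogMn _ (XD a)).
have y2D : y2 \is E.-homog by rewrite ab; apply: dhomogM (FD _) (dhomogMn _ (XD b)).
have [|||||i i0 nz] := @moving_line_avoids K unit y1 y2 (fun _ u _ => u ^+ m.+1)
    (fun _ _ v => v ^+ m.+1) (fun _ u _ => u ^+ m.+1) (fun _ _ v => v ^+ m.+1)
    _ _ _ _ _ y20.
- by move=> *; rewrite rmorphXn.
- by move=> *; rewrite rmorphXn.
- by move=> _; rewrite expr1n oner_neq0.
- by move=> _; rewrite expr0n.
- by move=> _; rewrite expr1n oner_neq0.
set l := moving_line i in nz.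
have lD t : l t ^+ m.+1 \is m.+1.-homog.
  by rewrite -[X in X.-homog]mul1n; apply: dhomogMn; exact: moving_line_homog.
have l0 t : l t != 0.
  apply/eqP => /(congr1 (meval (fun j : 'I_3 => (j == i)%:R))); rewrite meval0.
  rewrite moving_line_eval eqxx eq_sym (negPf i0) mulr0 add0r => /eqP.
  by rewrite oner_eq0.
pose g t : {mpoly K[3]} := y1 * 'X_0 ^+ m.+1 + y2 * l t ^+ m.+1.
have gD t : g t \is (E + m.+1).-homog.
  exact: dhomogD (dhomogM y1D (XD _)) (dhomogM y2D (lD t)).
pose h t (j : 'I_3) : {mpoly K[3]} := if j == 0 then - F 0 ^+ m * g t
  else if j == 1 then F 0 * 'X_0 ^+ a * 'X_0 else F 0 * 'X_0 ^+ b * l t.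
pose e (j : 'I_3) := if j == 0 then (degree (F 0%R) * m + (E + m.+1))%N
  else if j == 1 then (degree (F 0%R) + a + 1)%N else (degree (F 0%R) + b + 1)%N.
have hD t j : h t j \is (e j).-homog.
  move: j; apply: forall3; rewrite /h /e /=.
  - by apply: dhomogM => //; rewrite rpredN; apply: dhomogMn.
  - by apply: dhomogM (dhomogXi K 0); apply: dhomogM.
  - by apply: dhomogM (moving_line_homog i t); apply: dhomogM.
have nzh t j : h t j != 0.
  move: j; apply: forall3; rewrite /h /=.
  - by rewrite mulf_neq0 ?oppr_eq0 ?expf_neq0 ?(fF _).1// (nz tt).
  - by rewrite !mulf_neq0 ?expf_neq0 ?(fF _).1.
  - by rewrite !mulf_neq0 ?expf_neq0 ?(fF _).1.
apply: (@affine_line_family _ F p e h) => //.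
- have pl := moving_line_param K i.
  apply: forall3; rewrite /h /= /g; repeat first [exact: param_cst | assumption
   | apply: param_opp | apply: param_add | apply: param_exp | apply: param_mul].
- move=> t.
  have T0 : F 0 * h t 0 ^+ p 0%R = - (F 0 ^+ m.+1 * g t).
    by rewrite p0 expr1 /h /= mulNr mulrN mulrA exprS.
  have T1 : F 1 * h t 1 ^+ p 1%R = F 0 ^+ m.+1 * (y1 * 'X_0 ^+ m.+1).
    by rewrite p1 /h /= /y1 !exprMn -!mulrA [LHS]mulrCA.
  have T2 : F 2%R * h t 2%R ^+ p 2%R = F 0 ^+ m.+1 * (y2 * l t ^+ m.+1).
    by rewrite p2 /h /= /y2 !exprMn -!mulrA [LHS]mulrCA.
  have F0D := dhomogMn m.+1 (FD 0).
  split.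
  + by move=> j; split; [exact: nzh | exact: homogE (hD t j)].
  + exists (degree (F 0%R) * m.+1 + (E + m.+1))%N.
    apply: forall3; first by rewrite T0 rpredN; exact: dhomogM F0D (gD t).
      by rewrite T1; exact: dhomogM F0D (dhomogM y1D (XD _)).
    by rewrite T2; exact: dhomogM F0D (dhomogM y2D (lD t)).
  + by rewrite sum3E T0 T1 T2 -addrA -mulrDr addNr.
move=> s t [U [V [fU fV UV]]].
have w1 : weight p 1 = 1%N.
  by rewrite /weight big3 /= p0 p1 p2 lcm1n (lcmn_idPl (dvdnn _)) divnn.
have w2 : weight p 2%R = 1%N.
  by rewrite /weight big3 /= p0 p1 p2 lcm1n (lcmn_idPl (dvdnn _)) divnn.
have h1 x : h x 1 = F 0 * 'X_0 ^+ a * 'X_0 by rewrite /h /=.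
have h2 x : h x 2%R = F 0 * 'X_0 ^+ b * l x by rewrite /h /=.
have h10 := nzh t 1; rewrite h1 in h10.
have := UV 1; rewrite w1 !expr1 !h1 => /(mulIf h10) eUV.
have := UV 2%R; rewrite w2 !expr1 -eUV !h2 => /(mulfI fU.1).
move/(mulfI (mulf_neq0 (fF 0).1 (expf_neq0 b X0))); exact: moving_line_inj.
Qed.

End LinearFamily.

Lemma family_sufficient (K : numFieldType) (F : 'I_3 -> {mpoly K[3]})
    (p : 'I_3 -> nat) :
  (forall i, is_form (F i)) -> reduced_type p ->
  ([/\ p 0 = 2%N, p 1 = 2%N & p 2%R = 2%N] /\ exists h, quasi_toric p F h) \/
  (p 0 = 1%N /\ ((p 1%R)%:Z %| (degree (F 1%R))%:Z - (degree (F 2%R))%:Z)%Z) ->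
  positive_dim_rational_family p F.
Proof.
move=> fF pred [[[p0 p1 p2] [h qh]]|[p0 /dvdzP[c cE]]].
  by apply: (conic_family fF _ qh); apply: forall3.
have [_ d1 d2] := reduced_type_dvd pred.
have p12 : p 2%R = p 1.
  by rewrite p0 !lcm1n in d1 d2; apply/eqP; rewrite eqn_dvd d1 d2.
have := reduced_type_gt0 pred 1; case p1: (p 1) p12 cE => [//|m] p2 cE _.
case: c cE => n cE.
  by apply: (linear_family fF p0 p1 p2 (a := 0) (b := n)); lia.
by apply: (linear_family fF p0 p1 p2 (a := n.+1) (b := 0)); lia.
Qed.

Theorem theorem1p1 (R : realType) (F : triple {mpoly R[i][3]})
    (p : triple nat) :
  (forall i, is_form (F i)) ->
  reduced_type p -> (p 0%R <= p 1%R <= p 2%R)%N ->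
  positive_dim_rational_family p F <->
  ([/\ p 0 = 2%N, p 1 = 2%N & p 2 = 2%N] /\ exists h, quasi_toric p F h) \/
  (p 0 = 1%N /\ ((p 1%R)%:Z %| (degree (F 1%R))%:Z - (degree (F 2%R))%:Z)%Z).
Proof.
move=> fF p_reduced p_sorted; split; first exact: family_necessary.
exact: family_sufficient.
Qed.
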